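(* Let $\xi>0$ be real, $\theta\in[0,\pi/5]$, $u=e^{i\theta}$, let $y^*$ be the distinguished root of $\frac{y^5+uy^4}{2}=\xi$ and $(y_k)_{k\in\mathbb N}$ the iteration-of-radicals sequence, both defined in the context. Let $K=15.44$ and $C_0=4.32\times10^{-3}$. Then for all integers $k\ge 1$, $$|y_{k+1}-y^*|<\frac1K\,|y_k-y^*|\qquad\text{and}\qquad |y_{k+1}-y^*|<\frac{C_0}{K^k}.$$
   Context: Convention: the $n$-th root of a complex number is the one whose argument lies in $[-\pi/n,\pi/n[$. Distinguished root $y^*$: for $\xi>0$, $\theta\in\,]0,\pi/5]$ and $u=e^{i\theta}$, the equation $\frac{y^5+uy^4}{2}=\xi$ has exactly one root of the form $re^{i\sigma}$ with $r>0$ and $\sigma\in[-\theta/4,0[$; this root is called $y^*$. For $\theta=0$ (so $u=1$), $y^*$ is the unique positive real root of the equation. Sequence: $y_0=(\xi/\alpha)^{2/9}>0$ with $\alpha=\sqrt{\frac{2+\sqrt2}{4}}$, and for $k\ge0$ $$y_{k+1}=\sqrt[5]{2\xi+\frac{2u^2}{5}t_k^3+\frac{2u^3}{25}t_k^2+\frac{u^4}{125}t_k+\frac{u^5}{3125}}-\frac{u}{5},\qquad t_k=\sqrt[4]{\frac{2\xi}{u+y_k}}.$$ *)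

(* Defs.v *)
From Stdlib Require Import Reals Lra Lia ClassicalEpsilon.
From Coquelicot Require Import Coquelicot.
Local Open Scope R_scope.

Definition polar (r s : R) : C := (r * cos s, r * sin s).

(* [0 <= r] rather than [0 < r], so that the root of 0 is 0. *)
Definition is_Croot (n : nat) (z w : C) : Prop :=
  (w ^ n)%C = z /\
  exists r s : R, 0 <= r /\ - PI / INR n <= s < PI / INR n /\ w = polar r s.

Definition Croot (n : nat) (z : C) : C :=
  epsilon (inhabits (RtoC 0)) (is_Croot n z).

Definition is_ystar (xi theta : R) (y : C) : Prop :=
  ((y ^ 5 + polar 1 theta * y ^ 4) / 2 = xi)%C /\
  ((theta = 0 /\ exists r : R, 0 < r /\ y = RtoC r) \/
   (0 < theta /\
    exists r s : R, 0 < r /\ - theta / 4 <= s < 0 /\ y = polar r s)).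

Definition alpha : R := sqrt ((2 + sqrt 2) / 4).

Definition tstep (xi theta : R) (y : C) : C :=
  Croot 4 (2 * xi / (polar 1 theta + y))%C.

Definition ystep (xi theta : R) (y : C) : C :=
  let u := polar 1 theta in
  let t := tstep xi theta y in
  (Croot 5 (2 * xi + 2 * u ^ 2 / 5 * t ^ 3 + 2 * u ^ 3 / 25 * t ^ 2
            + u ^ 4 / 125 * t + u ^ 5 / 3125) - u / 5)%C.

Fixpoint yseq (xi theta : R) (k : nat) : C :=
  match k with
  | O => RtoC (Rpower (xi / alpha) (2 / 9))
  | S k' => ystep xi theta (yseq xi theta k')
  end.

Lemma polar_mul (r s r' s' : R) :
  (polar r s * polar r' s')%C = polar (r * r') (s + s').
Proof.
unfold polar, Cmult; simpl; rewrite cos_plus, sin_plus; f_equal; ring.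
Qed.

Lemma polar_pow (r s : R) (n : nat) :
  (polar r s ^ n)%C = polar (r ^ n) (INR n * s).
Proof.
induction n as [|n IH].
- simpl; unfold polar; rewrite Rmult_0_l, cos_0, sin_0.
  unfold RtoC; f_equal; ring.
- rewrite Cpow_S, IH, polar_mul, S_INR; simpl; f_equal; ring.
Qed.

Lemma Cmod_polar (r s : R) : 0 <= r -> Cmod (polar r s) = r.
Proof.
intros Hr; unfold Cmod, polar; simpl.
replace (_ + _) with (r * r * (Rsqr (sin s) + Rsqr (cos s)))
  by (unfold Rsqr; ring).
rewrite sin2_cos2, Rmult_1_r; apply sqrt_square, Hr.
Qed.

Lemma polar_exists (z : C) :
  exists r s : R, 0 <= r /\ - PI <= s < PI /\ z = polar r s.
Proof.
pose proof PI_RGT_0 as HPI.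
destruct z as [a b].
destruct (Req_dec (Cmod (a, b)) 0) as [H0|H0].
- exists 0, 0; repeat split; try lra.
  apply Cmod_eq_0 in H0; rewrite H0; unfold polar, RtoC; f_equal; ring.
- set (m := Cmod (a, b)) in *.
  assert (Hm : 0 < m) by (pose proof (Cmod_ge_0 (a, b)); fold m in H; lra).
  assert (Hm2 : m * m = a * a + b * b).
  { unfold m, Cmod; simpl; rewrite sqrt_sqrt; nra. }
  assert (Hab : (a / m) * (a / m) + (b / m) * (b / m) = 1).
  { replace 1 with ((a * a + b * b) / (m * m)) by (rewrite <- Hm2; field; lra).
    field; lra. }
  assert (Ha : -1 <= a / m <= 1) by (split; nra).
  pose proof (acos_bound (a / m)) as Hac.
  pose proof (cos_acos _ Ha) as Hcos.
  pose proof (sin_acos _ Ha) as Hsin.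
  assert (Hs2 : 1 - (a / m)² = (b / m)²) by (unfold Rsqr; lra).
  rewrite Hs2, sqrt_Rsqr_abs in Hsin.
  destruct (Rlt_dec 0 b) as [Hb|Hb].
  + assert (Hbm : 0 < b / m) by (apply Rdiv_lt_0_compat; lra).
    rewrite Rabs_pos_eq in Hsin by lra.
    exists m, (acos (a / m)); repeat split; try lra.
    * destruct Hac as [_ [Hlt|Heq]]; [exact Hlt|].
      rewrite Heq, sin_PI in Hsin; lra.
    * unfold polar; rewrite Hcos, Hsin; f_equal; field; lra.
  + assert (Hbm : b / m <= 0).
    { apply Rmult_le_reg_r with m; [lra|]; unfold Rdiv.
      rewrite Rmult_assoc, Rinv_l; lra. }
    rewrite Rabs_left1 in Hsin by lra.
    exists m, (- acos (a / m)); repeat split; try lra.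
    unfold polar; rewrite cos_neg, sin_neg, Hcos, Hsin; f_equal; field; lra.
Qed.

Lemma polar_inj (r s r' s' : R) :
  0 < r -> 0 < r' -> - PI <= s < PI -> - PI <= s' < PI ->
  polar r s = polar r' s' -> r = r' /\ s = s'.
Proof.
intros Hr Hr' Hs Hs' H.
assert (E : r = r').
{ rewrite <- (Cmod_polar r s), <- (Cmod_polar r' s'), H by lra; reflexivity. }
subst r'; split; [reflexivity|].
unfold polar in H; injection H as Hc Hsn.
apply Rmult_eq_reg_l in Hc; [|lra]; apply Rmult_eq_reg_l in Hsn; [|lra].
assert (Hh : cos (s - s') = 1).
{ rewrite cos_minus, Hc, Hsn; pose proof (sin2_cos2 s') as P.
  unfold Rsqr in P; lra. }
replace (s - s') with (2 * ((s - s') / 2)) in Hh by field.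
rewrite cos_2a_sin in Hh.
assert (Hz : sin ((s - s') / 2) = 0) by nra.
destruct (Rtotal_order s s') as [L|[L|L]]; [|exact L|]; exfalso.
- assert (0 < sin ((s' - s) / 2)) by (apply sin_gt_0; lra).
  replace ((s - s') / 2) with (- ((s' - s) / 2)) in Hz by field.
  rewrite sin_neg in Hz; lra.
- assert (0 < sin ((s - s') / 2)) by (apply sin_gt_0; lra); lra.
Qed.

Lemma Croot_spec (n : nat) (z : C) : (0 < n)%nat -> is_Croot n z (Croot n z).
Proof.
intros Hn; unfold Croot; apply epsilon_spec.
pose proof PI_RGT_0 as HPI.
assert (Hn' : 0 < INR n) by (apply lt_0_INR; exact Hn).
destruct (polar_exists z) as (r & s & [Hr|Hr] & Hs & ->).
- exists (polar (Rpower r (/ INR n)) (s / INR n)); split.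
  + rewrite polar_pow; f_equal; [|field; lra].
    rewrite <- Rpower_pow by apply exp_pos.
    rewrite Rpower_mult, Rinv_l, Rpower_1; lra.
  + exists (Rpower r (/ INR n)), (s / INR n); repeat split.
    * apply Rlt_le, exp_pos.
    * apply Rmult_le_compat_r; [apply Rlt_le, Rinv_0_lt_compat|]; lra.
    * apply Rmult_lt_compat_r; [apply Rinv_0_lt_compat|]; lra.
- subst r; exists (polar 0 0); split.
  + rewrite polar_pow, pow_i by lia; unfold polar; f_equal; ring.
  + exists 0, 0; repeat split; try lra.
    * replace (- PI / INR n) with (- (PI / INR n)) by (field; lra).
      pose proof (Rdiv_lt_0_compat _ _ HPI Hn'); lra.
    * apply Rdiv_lt_0_compat; lra.
Qed.

Lemma is_Croot_unique (n : nat) (z w w' : C) :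
  (0 < n)%nat -> is_Croot n z w -> is_Croot n z w' -> w = w'.
Proof.
intros Hn [Hw (r & s & Hr & Hs & ->)] [Hw' (r' & s' & Hr' & Hs' & ->)].
assert (Hn' : 0 < INR n) by (apply lt_0_INR; exact Hn).
assert (Harg : forall x, - PI / INR n <= x < PI / INR n ->
  - PI <= INR n * x < PI).
{ intros x [H1 H2]; split.
  - replace (- PI) with (INR n * (- PI / INR n)) by (field; lra); nra.
  - replace PI with (INR n * (PI / INR n)) at 1 by (field; lra); nra. }
rewrite <- Hw in Hw'; rewrite !polar_pow in Hw'.
assert (Hmod : r' ^ n = r ^ n).
{ rewrite <- (Cmod_polar (r' ^ n) (INR n * s')) by (apply pow_le; lra).
  rewrite Hw'; apply Cmod_polar, pow_le; lra. }
assert (Hlt : forall a b, 0 <= a -> a < b -> a ^ n < b ^ n).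
{ intros a b Ha Hab; clear - Hn Ha Hab.
  destruct n as [|n]; [lia|]; clear Hn.
  induction n as [|n IH]; [simpl; lra|].
  change (a * a ^ S n < b * b ^ S n).
  pose proof (pow_le a (S n) Ha); nra. }
assert (Hrr : r' = r).
{ destruct (Rtotal_order r r') as [L|[L|L]]; [|lra|]; exfalso.
  - pose proof (Hlt r r' Hr L); lra.
  - pose proof (Hlt r' r Hr' L); lra. }
subst r'; destruct Hr as [Hr|Hr].
- apply polar_inj in Hw'; auto using pow_lt.
  destruct Hw' as [_ E]; apply Rmult_eq_reg_l in E; [subst; reflexivity|lra].
- subst r; unfold polar; rewrite !Rmult_0_l; reflexivity.
Qed.

Lemma is_ystar_exists (xi theta : R) :
  0 < xi -> 0 <= theta <= PI / 5 -> exists y : C, is_ystar xi theta y.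
Proof.
intros Hxi [Hth Hth5]; pose proof PI_RGT_0 as HPI.
destruct (Req_dec theta 0) as [->|Hne].
- destruct (IVT (fun r => r ^ 5 + r ^ 4 - 2 * xi) 0 (1 + 2 * xi))
    as (r & Hr & E); [reg|lra|simpl; lra| |].
  + assert (1 + 2 * xi <= (1 + 2 * xi) ^ 5).
    { rewrite <- (pow_1 (1 + 2 * xi)) at 1; apply Rle_pow; [lra|lia]. }
    assert (0 <= (1 + 2 * xi) ^ 4) by (apply pow_le; lra).
    lra.
  + simpl in E.
    assert (0 < r) by (destruct (Req_dec r 0) as [->|]; lra).
    exists (RtoC r); split; [|left; eauto].
    unfold polar; rewrite cos_0, sin_0, Rmult_1_r, Rmult_0_r.
    change (1, 0) with (RtoC 1).
    rewrite <- !RtoC_pow, <- RtoC_mult, <- RtoC_plus, <- RtoC_div by lra.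
    f_equal; lra.
- set (N := fun s => sin (theta + 4 * s)).
  set (D := fun s => sin (- 5 * s)).
  destruct (IVT (fun s => N s ^ 4 * sin (theta - s) - 2 * xi * D s ^ 5)
                (- theta / 4) 0) as (s & Hs & E).
  + unfold N, D; reg.
  + lra.
  + assert (HN : N (- theta / 4) = 0).
    { unfold N; replace (theta + _) with 0 by field; apply sin_0. }
    assert (HD : 0 < D (- theta / 4)) by (apply sin_gt_0; lra).
    rewrite HN; pose proof (pow_lt _ 5 HD); simpl pow in *; nra.
  + assert (HN : 0 < N 0) by (apply sin_gt_0; lra).
    assert (HD : D 0 = 0) by (unfold D; rewrite Rmult_0_r; apply sin_0).
    assert (HT : 0 < sin (theta - 0)) by (apply sin_gt_0; lra).
    rewrite HD; pose proof (pow_lt _ 4 HN); simpl pow in *; nra.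
  + assert (Hs0 : s < 0).
    { destruct (Req_dec s 0) as [->|]; [exfalso|lra].
      assert (HN : 0 < N 0) by (apply sin_gt_0; lra).
      assert (HD : D 0 = 0) by (unfold D; rewrite Rmult_0_r; apply sin_0).
      assert (HT : 0 < sin (theta - 0)) by (apply sin_gt_0; lra).
      rewrite HD in E; pose proof (pow_lt _ 4 HN); simpl pow in *; nra. }
    assert (HD : 0 < D s) by (apply sin_gt_0; lra).
    assert (HN : 0 < N s).
    { assert (0 <= N s) by (apply sin_ge_0; lra).
      destruct (Req_dec (N s) 0) as [H0|]; [exfalso|lra].
      rewrite H0 in E; pose proof (pow_lt _ 5 HD); simpl pow in *; nra. }
    exists (polar (N s / D s) s); split.
    2: { right; split; [lra|]; exists (N s / D s), s; repeat split; try lra.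
         apply Rdiv_lt_0_compat; assumption. }
    rewrite !polar_pow, polar_mul.
    replace (INR 5) with 5 by (simpl; ring).
    replace (INR 4) with 4 by (simpl; ring).
    set (r := N s / D s).
    assert (E5 : D s = - sin (5 * s)).
    { unfold D; rewrite <- sin_neg; f_equal; ring. }
    assert (Hr : r * sin (5 * s) + sin (theta + 4 * s) = 0).
    { fold (N s); replace (sin (5 * s)) with (- D s) by lra.
      unfold r; field; lra. }
    assert (Hc : r ^ 4 * (r * cos (5 * s) + cos (theta + 4 * s)) = 2 * xi).
    { assert (T : N s * cos (5 * s) + D s * cos (theta + 4 * s)
                  = sin (theta - s)).
      { rewrite E5; replace (theta - s) with ((theta + 4 * s) - 5 * s) by ring.
        rewrite sin_minus; unfold N; ring. }
      replace (r ^ 4 * _) with (N s ^ 4 * sin (theta - s) / D s ^ 5)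
        by (rewrite <- T; unfold r; field; lra).
      replace (N s ^ 4 * sin (theta - s)) with (2 * xi * D s ^ 5) by lra.
      field; lra. }
    assert (Hsum : (polar (r ^ 5) (5 * s) + polar (1 * r ^ 4) (theta + 4 * s)
                    = RtoC (2 * xi))%C).
    { unfold polar, Cplus, RtoC; simpl fst; simpl snd; f_equal.
      - rewrite <- Hc; ring.
      - replace (_ + _) with
          (r ^ 4 * (r * sin (5 * s) + sin (theta + 4 * s))) by ring.
        rewrite Hr; ring. }
    rewrite Hsum, <- RtoC_div; f_equal; lra.
Qed.

(* Main.v *)
Require Import Defs.
From Stdlib Require Import Reals Lra Lia.
From Coquelicot Require Import Coquelicot.
Local Open Scope R_scope.

(* Write [u = e^(i theta)], [y* = r e^(i s)], [U = |u + y*|], [R = |u + y_k|].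
   The point [u + y_k] always lies in the sector of arguments [0, theta], so
   [t_k] has argument in [-theta/4, 0], as [y*] does, and the radicand avoids
   the cut of the fifth root.  Hence [y*] is a fixed point of the step, and
   factoring [t^4 - y*^4] and [V^5 - V*^5] (with [V = y + u/5]) inside these
   sectors gives, to first order,
   [|y_(k+1) - y*| <= r (6/5 r^2 + 4/25 r + 1/125) / (20 U |V*|^4) |y_k - y*|].
   Since [U >= 0.92 (1 + r)] and [|V*| >= 0.92 (r + 1/5)], this factor stays
   below 0.05, which leaves room for the nonlinear terms when
   [|y_k - y*| <= C_0].  The first step, where [|y_0 - y*|] is unbounded, rests
   on [(2 + sqrt 2) y_0^9 = r^8 U^2], which gives [r <= y_0] and bounds
   [y_0 - r] by Bernoulli's inequality. *)

(** * Components along a direction, and sums of points of a sector *)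

(** The real part of [z * e^(-i c)]. Being additive and at most the modulus, it bounds the modulus
    of a sum from below when all terms have arguments near [c]. *)
Definition proj (c : R) (z : C) : R := fst z * cos c + snd z * sin c.

Lemma proj_plus (c : R) (z w : C) : proj c (z + w)%C = proj c z + proj c w.
Proof. unfold proj; simpl; ring. Qed.

Lemma proj_le_Cmod (c : R) (z : C) : proj c z <= Cmod z.
Proof.
apply Rle_trans with (1 := Rle_abs _).
rewrite <- (sqrt_Rsqr_abs (proj c z)); apply sqrt_le_1_alt.
unfold proj, Rsqr; pose proof (sin2_cos2 c) as E; unfold Rsqr in E.
pose proof (pow2_ge_0 (fst z * sin c - snd z * cos c)) as P.
assert (fst z ^ 2 + snd z ^ 2 =
  (fst z * cos c + snd z * sin c) * (fst z * cos c + snd z * sin c)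
  + (fst z * sin c - snd z * cos c) ^ 2); [|lra].
transitivity ((fst z ^ 2 + snd z ^ 2) * (sin c * sin c + cos c * cos c)).
- rewrite E; ring.
- ring.
Qed.

Lemma proj_polar (c r s : R) : proj c (polar r s) = r * cos (s - c).
Proof. unfold proj, polar; simpl; rewrite cos_minus; ring. Qed.

Lemma proj_polar_ge (c h r s : R) :
  0 <= r -> h <= PI -> c - h <= s <= c + h -> cos h * r <= proj c (polar r s).
Proof.
intros Hr Hh Hs; rewrite proj_polar, Rmult_comm.
apply Rmult_le_compat_l; [exact Hr|].
destruct (Rle_dec 0 (s - c)) as [P|P].
- apply cos_decr_1; lra.
- rewrite <- (cos_neg (s - c)); apply cos_decr_1; lra.
Qed.

(** Rotating [s] to 0 and writing [d = s' - s], the imaginary part of the sum shows [sin e > 0], and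
    its component across the second direction shows [sin (d - e) > 0], so [e] falls between the two
    arguments. The strict clause serves later to stay off the branch cut of a root. *)
Lemma polar_add (r s r' s' : R) :
  0 < r -> 0 < r' -> s <= s' -> s' < s + PI ->
  exists R e, 0 < R /\ s <= e <= s' /\ (s < s' -> e < s') /\
    (polar r s + polar r' s')%C = polar R e.
Proof.
intros Hr Hr' Hs Hs'; pose proof PI_RGT_0 as HPI.
destruct (Req_dec s s') as [<-|Hne].
- exists (r + r'), s; repeat split; try lra.
  unfold polar, Cplus; simpl; f_equal; ring.
- set (d := s' - s).
  destruct (polar_exists (polar r 0 + polar r' d)%C) as (m & e & Hm & He & E).
  assert (Hd : 0 < sin d) by (apply sin_gt_0; unfold d; lra).
  pose proof E as E0; unfold polar, Cplus in E0; simpl in E0.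
  rewrite cos_0, sin_0 in E0; injection E0 as E1 E2.
  assert (P : 0 < m * sin e) by nra.
  assert (Pm : 0 < m) by (destruct (Req_dec m 0) as [->|]; lra).
  assert (Ps : 0 < sin e) by (destruct (Rlt_dec 0 (sin e)); nra).
  assert (He0 : 0 < e).
  { destruct (Rlt_dec 0 e) as [|N]; [assumption|exfalso].
    assert (0 <= sin (- e)) by (apply sin_ge_0; lra).
    rewrite sin_neg in *; lra. }
  assert (Q : 0 < sin (d - e)).
  { assert (m * sin (d - e) = r * sin d).
    { rewrite sin_minus.
      replace (m * _) with (sin d * (m * cos e) - cos d * (m * sin e)) by ring.
      rewrite <- E1, <- E2; ring. }
    destruct (Rlt_dec 0 (sin (d - e))); nra. }
  assert (He1 : e < d).
  { destruct (Rlt_dec e d) as [|N]; [assumption|exfalso].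
    assert (0 <= sin (- (d - e))) by (apply sin_ge_0; unfold d in *; lra).
    rewrite sin_neg in *; lra. }
  exists m, (s + e); unfold d in *; repeat split; try lra.
  replace (polar m (s + e)) with (polar 1 s * polar m e)%C
    by (rewrite polar_mul; f_equal; ring).
  rewrite <- E, Cmult_plus_distr_l, !polar_mul; f_equal; f_equal; ring.
Qed.

Lemma Croot_polar (n : nat) (r s : R) :
  (0 < n)%nat -> 0 < r -> - PI <= s < PI ->
  exists q, 0 < q /\ q ^ n = r /\ Croot n (polar r s) = polar q (s / INR n).
Proof.
intros Hn Hr Hs.
assert (Hn' : 0 < INR n) by (apply lt_0_INR; exact Hn).
exists (Rpower r (/ INR n)).
assert (E : Rpower r (/ INR n) ^ n = r).
{ rewrite <- Rpower_pow by apply exp_pos.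
  rewrite Rpower_mult, Rinv_l, Rpower_1; lra. }
split; [apply exp_pos|split; [exact E|]].
apply is_Croot_unique with n (polar r s); [exact Hn|apply Croot_spec, Hn|].
split.
- rewrite polar_pow, E; f_equal; field; lra.
- exists (Rpower r (/ INR n)), (s / INR n); repeat split.
  + apply Rlt_le, exp_pos.
  + apply Rmult_le_compat_r; [apply Rlt_le, Rinv_0_lt_compat|]; lra.
  + apply Rmult_lt_compat_r; [apply Rinv_0_lt_compat|]; lra.
Qed.

(** * Arguments of the fourth root, of the radicand and of the fifth root *)

(** This is [(t + u/5)^5] with its two leading terms [t^5 + u t^4] replaced by [2 xi], the value
    they take at [t = y*]. *)
Definition radicand (xi : R) (u t : C) : C :=
  (2 * xi + 2 * u ^ 2 / 5 * t ^ 3 + 2 * u ^ 3 / 25 * t ^ 2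
   + u ^ 4 / 125 * t + u ^ 5 / 3125)%C.

Lemma RtoC_polar (r : R) : RtoC r = polar r 0.
Proof. unfold polar, RtoC; rewrite cos_0, sin_0; f_equal; ring. Qed.

Lemma polar_scal (a r s : R) : (a * polar r s)%C = polar (a * r) s.
Proof. rewrite RtoC_polar, polar_mul; f_equal; ring. Qed.

(** The terms other than [2 xi] have increasing arguments [2 theta + 3 tau], ..., [5 theta], all
    nonnegative since [tau >= - theta / 4]. They are added in that order, and [2 xi], of argument 0,
    comes last. *)
Lemma radicand_polar (xi theta T tau : R) :
  0 < xi -> 0 <= theta <= PI / 5 -> 0 < T -> - theta / 4 <= tau <= 0 ->
  exists B beta, 0 < B /\ 0 <= beta <= 5 * theta /\ beta < PI /\
    radicand xi (polar 1 theta) (polar T tau) = polar B beta.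
Proof.
intros Hxi Hth HT Htau; pose proof PI_RGT_0 as HPI.
unfold radicand.
replace (2 * xi + _ + _ + _ + _)%C with
  (polar (2 / 5 * T ^ 3) (2 * theta + 3 * tau)
   + polar (2 / 25 * T ^ 2) (3 * theta + 2 * tau)
   + polar (/ 125 * T) (4 * theta + tau)
   + polar (/ 3125) (5 * theta) + polar (2 * xi) 0)%C.
2: { rewrite !polar_pow, <- RtoC_polar, RtoC_mult.
  rewrite <- (Rmult_1_r (/ 3125)), <- !polar_scal.
  replace (polar (T ^ 3) (2 * theta + 3 * tau))
    with (polar (1 ^ 2) (INR 2 * theta) * polar (T ^ 3) (INR 3 * tau))%C
    by (rewrite polar_mul; simpl INR; f_equal; ring).
  replace (polar (T ^ 2) (3 * theta + 2 * tau))
    with (polar (1 ^ 3) (INR 3 * theta) * polar (T ^ 2) (INR 2 * tau))%C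
    by (rewrite polar_mul; simpl INR; f_equal; ring).
  replace (polar T (4 * theta + tau))
    with (polar (1 ^ 4) (INR 4 * theta) * polar T tau)%C
    by (rewrite polar_mul; simpl INR; f_equal; ring).
  replace (polar 1 (5 * theta)) with (polar (1 ^ 5) (INR 5 * theta))
    by (simpl INR; f_equal; ring).
  rewrite !RtoC_inv, !RtoC_div by lra.
  field. }
pose proof (pow_lt T 3 HT); pose proof (pow_lt T 2 HT).
destruct (polar_add (2 / 5 * T ^ 3) (2 * theta + 3 * tau)
  (2 / 25 * T ^ 2) (3 * theta + 2 * tau))
  as (R1 & e1 & P1 & Q1 & _ & ->); [lra..|].
destruct (polar_add R1 e1 (/ 125 * T) (4 * theta + tau))
  as (R2 & e2 & P2 & Q2 & _ & ->); [lra..|].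
destruct (polar_add R2 e2 (/ 3125) (5 * theta))
  as (R3 & e3 & P3 & Q3 & S3 & ->); [lra..|].
(* At [theta = PI / 5] the bound [5 theta] is [PI] itself, which the root convention excludes; the
   strict clause of [polar_add] rules it out. The case [e2 = 5 theta] forces [theta = 0]. *)
assert (e3 < PI).
{ destruct (Req_dec e2 (5 * theta)); [|assert (e3 < 5 * theta) by (apply S3; lra)];
  lra. }
destruct (polar_add (2 * xi) 0 R3 e3) as (R4 & e4 & P4 & Q4 & _ & E4); [lra..|].
exists R4, e4; rewrite Cplus_comm, E4; repeat split; lra.
Qed.

(** The fourth root turns the argument [-d] into [-d / 4], and the fifth root turns a radicand of
    argument in [[0, 5 theta]] into a shifted iterate [V = y' + u/5] of argument in [[0, theta]]. It
    is applied to the iterates and to [y*] alike. *)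
Lemma ystep_sector (xi theta R d : R) (y : C) :
  0 < xi -> 0 <= theta <= PI / 5 -> 0 < R -> 0 <= d <= theta ->
  (polar 1 theta + y)%C = polar R d ->
  let t := tstep xi theta y in
  exists T tau P nu,
    0 < T /\ - theta / 4 <= tau <= 0 /\ t = polar T tau /\
    (t ^ 4 * (polar 1 theta + y) = 2 * xi)%C /\
    0 < P /\ 0 <= nu <= theta /\
    (ystep xi theta y + polar 1 theta / 5)%C = polar P nu /\
    (polar P nu ^ 5)%C = radicand xi (polar 1 theta) t.
Proof.
intros Hxi Hth HR Hd E t; pose proof PI_RGT_0 as HPI.
assert (Et : (2 * xi / (polar 1 theta + y))%C = polar (2 * xi / R) (- d)).
{ rewrite E, <- RtoC_mult, RtoC_polar.
  replace (polar (2 * xi) 0) with (polar (2 * xi / R) (- d) * polar R d)%C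
    by (rewrite polar_mul; f_equal; field; lra).
  field; intros H0; apply (f_equal Cmod) in H0.
  rewrite Cmod_polar, Cmod_0 in H0; lra. }
assert (H2 : 0 < 2 * xi / R) by (apply Rdiv_lt_0_compat; lra).
destruct (Croot_polar 4 (2 * xi / R) (- d)) as (T & HT & ET & Ht); [lia|lra..|].
assert (Htt : t = polar T (- d / 4)).
{ unfold t, tstep; rewrite Et, Ht; f_equal; simpl INR; field. }
destruct (radicand_polar xi theta T (- d / 4)) as (B & b & HB & Hb & Hb' & EB);
  [lra..|].
destruct (Croot_polar 5 B b) as (P & HP & EP & HV); [lia|lra..|].
exists T, (- d / 4), P, (b / 5); repeat split; try lra; try assumption.
- rewrite E, Htt, polar_pow, polar_mul, ET.
  rewrite <- RtoC_mult, RtoC_polar; f_equal; [field; lra|simpl INR; field].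
- unfold ystep; fold (tstep xi theta y); fold t; rewrite Htt.
  fold (radicand xi (polar 1 theta) (polar T (- d / 4))).
  rewrite EB, HV; replace (INR 5) with 5 by (simpl; ring).
  field.
- rewrite Htt, EB, polar_pow, EP; f_equal; simpl INR; field.
Qed.

(** * The distinguished root in polar form and as a fixed point *)

Lemma ystar_polar (xi theta : R) (y : C) :
  0 <= theta <= PI / 5 -> is_ystar xi theta y ->
  exists r s, 0 < r /\ - theta / 4 <= s <= 0 /\ (0 < theta -> s < 0) /\
    y = polar r s /\ (y ^ 4 * (polar 1 theta + y) = 2 * xi)%C.
Proof.
intros Hth [E H].
assert (E' : (y ^ 4 * (polar 1 theta + y) = 2 * xi)%C).
{ rewrite <- E; field. }
destruct H as [[-> (r & Hr & ->)]|[Ht (r & s & Hr & Hs & ->)]].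
- exists r, 0; rewrite <- RtoC_polar; repeat split; try lra; exact E'.
- exists r, s; repeat split; try lra; exact E'.
Qed.

Lemma polar_neq_0 (r s : R) : 0 < r -> polar r s <> RtoC 0.
Proof.
intros Hr H; apply (f_equal Cmod) in H.
rewrite Cmod_polar, Cmod_0 in H; lra.
Qed.

(** The product of [u + y*] with [y*^4], which has argument [4 s], is the positive real [2 xi]. *)
Lemma ystar_shift_polar (xi theta r s : R) :
  0 < xi -> 0 < r ->
  (polar r s ^ 4 * (polar 1 theta + polar r s) = 2 * xi)%C ->
  exists U, 0 < U /\ r ^ 4 * U = 2 * xi /\
    (polar 1 theta + polar r s)%C = polar U (- (4 * s)).
Proof.
intros Hxi Hr E; pose proof (pow_lt r 4 Hr) as H4.
exists (2 * xi / r ^ 4); split; [apply Rdiv_lt_0_compat; lra|].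
split; [field; lra|].
assert (H4' : (polar r s ^ 4)%C <> 0%C)
  by (rewrite polar_pow; apply polar_neq_0; exact H4).
transitivity (polar r s ^ 4 * (polar 1 theta + polar r s) / polar r s ^ 4)%C.
- field; intros H0; apply H4'; rewrite H0; ring.
- replace (polar r s ^ 4 * (polar 1 theta + polar r s))%C
    with (polar (2 * xi / r ^ 4) (- (4 * s)) * polar r s ^ 4)%C.
  + field; intros H0; apply H4'; rewrite H0; ring.
  + rewrite E, polar_pow, polar_mul, <- RtoC_mult, RtoC_polar.
    f_equal; [field; lra|simpl INR; ring].
Qed.

Lemma ystar_fixed (xi theta r s : R) :
  0 < xi -> 0 <= theta <= PI / 5 -> 0 < r -> - theta / 4 <= s <= 0 ->
  (polar r s ^ 4 * (polar 1 theta + polar r s) = 2 * xi)%C ->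
  tstep xi theta (polar r s) = polar r s /\
  ystep xi theta (polar r s) = polar r s.
Proof.
intros Hxi Hth Hr Hs E; pose proof PI_RGT_0 as HPI.
destruct (ystar_shift_polar _ _ _ _ Hxi Hr E) as (U & HU & _ & EU).
assert (Et : tstep xi theta (polar r s) = polar r s).
{ unfold tstep; apply is_Croot_unique with 4%nat
    (2 * xi / (polar 1 theta + polar r s))%C;
    [lia|apply Croot_spec; lia|split].
  - rewrite <- E; field; rewrite EU; apply polar_neq_0; exact HU.
  - exists r, s; simpl INR; repeat split; lra. }
split; [exact Et|].
unfold ystep; rewrite Et.
fold (radicand xi (polar 1 theta) (polar r s)).
assert (EV : Croot 5 (radicand xi (polar 1 theta) (polar r s))
  = (polar r s + polar 1 theta / 5)%C).
{ apply is_Croot_unique with 5%nat (radicand xi (polar 1 theta) (polar r s));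
    [lia|apply Croot_spec; lia|split].
  - unfold radicand; rewrite <- E; field.
  - destruct (polar_add r s (/ 5) theta) as (R & e & HR & He & He' & Ee);
      [lra..|].
    exists R, e; replace (INR 5) with 5 by (simpl; ring); split; [lra|split].
    + destruct (Req_dec s theta); [lra|].
      assert (e < theta) by (apply He'; lra); lra.
    + rewrite <- Ee; f_equal.
      rewrite <- (Rmult_1_r (/ 5)), <- polar_scal, RtoC_inv by lra; field. }
rewrite EV; field.
Qed.

(** * Numerical bounds for sine, cosine and pi *)

Lemma sin_ge_cubic (x : R) : 0 <= x <= PI -> x - x ^ 3 / 6 <= sin x.
Proof.
intros Hx; destruct (sin_bound x 0) as [H _]; [lra..|].
unfold sin_approx, sin_term in H; simpl in H; lra.
Qed.

Lemma cos_ge_quadratic (x : R) : 0 <= x -> 1 - x ^ 2 / 2 <= cos x.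
Proof.
intros Hx; replace x with (2 * (x / 2)) at 2 by field.
rewrite cos_2a_sin.
destruct (Rle_dec x 2) as [H|H].
- assert (0 <= sin (x / 2)) by (apply sin_ge_0; pose proof PI2_3_2; lra).
  assert (sin (x / 2) <= x / 2).
  { destruct (Req_dec x 0) as [->|]; [|apply Rlt_le, sin_lt_x; lra].
    replace (0 / 2) with 0 by field; rewrite sin_0; lra. }
  nra.
- pose proof (SIN_bound (x / 2)); nra.
Qed.

(** Otherwise [0.525 = 3.15 / 6] would have a sine of at most [sin (PI / 6) = 1/2], against the
    cubic lower bound. *)
Lemma PI_lt_315 : PI < 3.15.
Proof.
destruct (Rlt_dec PI 3.15) as [|N]; [assumption|exfalso].
assert (H : sin 0.525 <= sin (PI / 6)) by (apply sin_incr_1; lra).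
rewrite sin_PI6 in H.
pose proof (sin_ge_cubic 0.525 ltac:(lra)); lra.
Qed.

(** * Lower bounds for differences of powers, and for sums, inside a sector *)

(** The four terms of the cofactor of [t - a] in [t^4 - a^4] have arguments in [[-3 theta / 4, 0]].
    Projecting on the middle direction costs at most the factor [cos (3 theta / 8) >= 0.97]. *)
Lemma fourth_power_gap (theta T tau r s : R) :
  0 <= theta <= PI / 5 -> 0 < T -> 0 < r ->
  - theta / 4 <= tau <= 0 -> - theta / 4 <= s <= 0 ->
  Cmod (polar T tau - polar r s)%C
    * (0.97 * (T ^ 3 + T ^ 2 * r + T * r ^ 2 + r ^ 3))
  <= Cmod (polar T tau ^ 4 - polar r s ^ 4)%C.
Proof.
intros Hth HT Hr Htau Hs; pose proof PI_lt_315 as HPI.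
pose proof PI_RGT_0 as HPI0.
pose proof (pow_lt T 3 HT); pose proof (pow_lt T 2 HT).
pose proof (pow_lt r 3 Hr); pose proof (pow_lt r 2 Hr).
replace (polar T tau ^ 4 - polar r s ^ 4)%C with
  ((polar T tau - polar r s) * (polar T tau ^ 3 + polar T tau ^ 2 * polar r s
    + polar T tau * polar r s ^ 2 + polar r s ^ 3))%C by ring.
rewrite Cmod_mult; apply Rmult_le_compat_l; [apply Cmod_ge_0|].
apply Rle_trans with (2 := proj_le_Cmod (- (3 * theta / 8)) _).
rewrite !polar_pow, !polar_mul, !proj_plus.
set (h := 3 * theta / 8).
assert (Hc : 0.97 <= cos h).
{ apply Rle_trans with (2 := cos_ge_quadratic h ltac:(unfold h; lra)).
  unfold h; nra. }
assert (K : forall a b, 0 <= a -> - h - h <= b <= - h + h ->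
  0.97 * a <= proj (- h) (polar a b)).
{ intros a b Ha Hb.
  apply Rle_trans with (cos h * a); [nra|].
  apply proj_polar_ge; unfold h in *; lra. }
pose proof (K (T ^ 3) (INR 3 * tau)) as K1.
pose proof (K (T ^ 2 * r) (INR 2 * tau + s)) as K2.
pose proof (K (T * r ^ 2) (tau + INR 2 * s)) as K3.
pose proof (K (r ^ 3) (INR 3 * s)) as K4.
simpl INR in *; unfold h in *.
assert (0 <= T ^ 2 * r) by nra; assert (0 <= T * r ^ 2) by nra.
lra.
Qed.

(** The arguments in the cofactor of [V - W] spread up to [4 PI / 5], so projecting gives only the
    factor [cos (2 PI / 5) >= 0.29]. With the assumed smallness of [V^5 - W^5] this already makes
    [V - W] small against [Q], and expanding the cofactor about [5 W^4] then raises its lower bound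
    close to [5 Q^4]. *)
Lemma fifth_power_gap (P nu Q mu : R) :
  0 < P -> 0 < Q -> 0 <= nu <= PI / 5 -> 0 <= mu <= PI / 5 ->
  Cmod (polar P nu ^ 5 - polar Q mu ^ 5)%C <= 0.06 * Q ^ 5 ->
  4.85 * Q ^ 4 * Cmod (polar P nu - polar Q mu)%C
    <= Cmod (polar P nu ^ 5 - polar Q mu ^ 5)%C.
Proof.
intros HP HQ Hnu Hmu.
pose proof PI_RGT_0 as HPI0.
set (V := polar P nu); set (W := polar Q mu).
set (S := (V ^ 4 + V ^ 3 * W + V ^ 2 * W ^ 2 + V * W ^ 3 + W ^ 4)%C).
replace (V ^ 5 - W ^ 5)%C with ((V - W) * S)%C by (unfold S; ring).
rewrite Cmod_mult; intros HN.
assert (HcW : Cmod W = Q) by (apply Cmod_polar; lra).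
assert (S0 : 0.29 * Q ^ 4 <= Cmod S).
{ apply Rle_trans with (2 := proj_le_Cmod (2 * PI / 5) _).
  unfold S, V, W; rewrite !polar_pow, !polar_mul, !proj_plus.
  assert (Hc : 0.29 <= cos (2 * PI / 5)).
  { replace (2 * PI / 5) with (PI / 2 - PI / 10) by field.
    rewrite cos_shift.
    assert (3 < PI) by (pose proof PI2_3_2; lra).
    assert (sin 0.3 <= sin (PI / 10)) by (apply sin_incr_1; lra).
    pose proof (sin_ge_cubic 0.3 ltac:(lra)); lra. }
  assert (K : forall a b, 0 < a -> 0 <= b <= 4 * PI / 5 ->
    0.29 * a <= proj (2 * PI / 5) (polar a b)).
  { intros a b Ha Hb.
    apply Rle_trans with (cos (2 * PI / 5) * a); [nra|].
    apply proj_polar_ge; lra. }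
  pose proof (pow_lt P 4 HP); pose proof (pow_lt P 3 HP).
  pose proof (pow_lt P 2 HP); pose proof (pow_lt Q 4 HQ).
  pose proof (pow_lt Q 3 HQ); pose proof (pow_lt Q 2 HQ).
  assert (0 < P ^ 3 * Q) by (apply Rmult_lt_0_compat; lra).
  assert (0 < P ^ 2 * Q ^ 2) by (apply Rmult_lt_0_compat; lra).
  assert (0 < P * Q ^ 3) by (apply Rmult_lt_0_compat; lra).
  pose proof (K (P ^ 4) (INR 4 * nu)) as K1.
  pose proof (K (P ^ 3 * Q) (INR 3 * nu + mu)) as K2.
  pose proof (K (P ^ 2 * Q ^ 2) (INR 2 * nu + INR 2 * mu)) as K3.
  pose proof (K (P * Q ^ 3) (nu + INR 3 * mu)) as K4.
  pose proof (K (Q ^ 4) (INR 4 * mu)) as K5.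
  simpl INR in *; lra. }
set (D := Cmod (V - W)%C) in *.
assert (HD : 0 <= D) by apply Cmod_ge_0.
assert (S1 : 5 * Q ^ 4 - (10 * Q ^ 3 * D + 10 * Q ^ 2 * D ^ 2 + 5 * Q * D ^ 3
  + D ^ 4) <= Cmod S).
{ set (d := (V - W)%C) in *.
  assert (E : (5 * W ^ 4 = S + - (10 * W ^ 3 * d + 10 * W ^ 2 * d ^ 2
    + 5 * W * d ^ 3 + d ^ 4))%C) by (unfold S, d; ring).
  apply (f_equal Cmod) in E.
  rewrite Cmod_mult, Cmod_R, Cmod_pow, HcW, Rabs_pos_eq in E by lra.
  pose proof (Cmod_triangle S (- (10 * W ^ 3 * d + 10 * W ^ 2 * d ^ 2
    + 5 * W * d ^ 3 + d ^ 4))%C) as T0.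
  rewrite <- E, Cmod_opp in T0.
  pose proof (Cmod_triangle (10 * W ^ 3 * d + 10 * W ^ 2 * d ^ 2
    + 5 * W * d ^ 3) (d ^ 4))%C as T1.
  pose proof (Cmod_triangle (10 * W ^ 3 * d + 10 * W ^ 2 * d ^ 2)
    (5 * W * d ^ 3))%C as T2.
  pose proof (Cmod_triangle (10 * W ^ 3 * d) (10 * W ^ 2 * d ^ 2))%C as T3.
  rewrite !Cmod_mult, !Cmod_R, !Cmod_pow, HcW in *.
  rewrite !Rabs_pos_eq in * by lra.
  fold D in T0, T1, T2, T3; lra. }
set (x := D / Q).
assert (Hx : 0 <= x) by (apply Rdiv_le_0_compat; lra).
assert (ED : D = x * Q) by (unfold x; field; lra).
set (m := Cmod S / Q ^ 4).
pose proof (pow_lt Q 4 HQ) as HQ4; pose proof (pow_lt Q 5 HQ) as HQ5.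
assert (Em : Cmod S = m * Q ^ 4) by (unfold m; field; lra).
rewrite Em, ED in *.
assert (M0 : 0.29 <= m) by nra.
assert (M1 : 5 - (10 * x + 10 * x ^ 2 + 5 * x ^ 3 + x ^ 4) <= m).
{ apply Rmult_le_reg_r with (Q ^ 4); [exact HQ4|].
  apply Rle_trans with (2 := S1); right; ring. }
assert (M2 : x * m <= 0.06).
{ apply Rmult_le_reg_r with (Q ^ 5); [exact HQ5|].
  apply Rle_trans with (2 := HN); right; ring. }
assert (Step : forall c b, 0 < c -> c <= m -> 0.06 <= c * b ->
  5 - (10 * b + 10 * b ^ 2 + 5 * b ^ 3 + b ^ 4) <= m).
{ intros c b Hc Hcm Hb.
  assert (x <= b) by nra.
  pose proof (pow_incr x b 2 ltac:(lra)); pose proof (pow_incr x b 3 ltac:(lra)).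
  pose proof (pow_incr x b 4 ltac:(lra)); lra. }
(* Each lower bound on [m] bounds [x] and so improves the bound on [m]. *)
pose proof (Step 0.29 0.207 ltac:(lra) M0 ltac:(lra)) as M3.
pose proof (Step 2.4 0.025 ltac:(lra) ltac:(lra) ltac:(lra)) as M4.
pose proof (Step 4.7 0.013 ltac:(lra) ltac:(lra) ltac:(lra)) as M5.
assert (M6 : 4.85 <= m) by lra.
replace (x * Q * (m * Q ^ 4)) with (m * (Q ^ 4 * (x * Q))) by ring.
replace (4.85 * Q ^ 4 * (x * Q)) with (4.85 * (Q ^ 4 * (x * Q))) by ring.
apply Rmult_le_compat_r; [|exact M6].
apply Rmult_le_pos; nra.
Qed.

Lemma Cmult_integral_l (z w : C) : w <> 0%C -> (z * w = 0)%C -> z = 0%C.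
Proof.
intros Hw H; destruct (Ceq_dec z 0) as [|Hz]; [assumption|].
destruct (Cmult_neq_0 z w Hz Hw H).
Qed.

(** Both summands lie within [PI / 8] of their bisector, and [cos (PI / 8) >= 0.92]. It applies to
    [u] and [y*] because [theta - s <= 5 theta / 4 <= PI / 4]. *)
Lemma Cmod_polar_add_ge (r s r' s' : R) :
  0 <= r -> 0 <= r' -> - (PI / 4) <= s - s' <= PI / 4 ->
  0.92 * (r + r') <= Cmod (polar r s + polar r' s')%C.
Proof.
intros Hr Hr' Hs; pose proof PI_lt_315; pose proof PI_RGT_0.
assert (Hc : 0.92 <= cos (PI / 8)).
{ apply Rle_trans with (2 := cos_ge_quadratic (PI / 8) ltac:(lra)); nra. }
apply Rle_trans with (2 := proj_le_Cmod ((s + s') / 2) _).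
rewrite proj_plus.
pose proof (proj_polar_ge ((s + s') / 2) (PI / 8) r s) as K1.
pose proof (proj_polar_ge ((s + s') / 2) (PI / 8) r' s') as K2.
nra.
Qed.

(** * From one error to the next: reduction to real inequalities *)

(** The divided difference of [radicand] between [t] and [a], in which [xi] cancels. *)
Definition radicand_slope (u t a : C) : C :=
  (u ^ 2 * (2 / 5 * (t ^ 2 + t * a + a ^ 2)) + 2 / 25 * u ^ 3 * (t + a)
   + u ^ 4 / 125)%C.

Lemma radicand_minus (xi : R) (u t a : C) :
  (radicand xi u t - radicand xi u a = (t - a) * radicand_slope u t a)%C.
Proof. unfold radicand, radicand_slope; field. Qed.

Lemma radicand_slope_le (theta : R) (t a : C) :
  Cmod (radicand_slope (polar 1 theta) t a) <=
  2 / 5 * (Cmod t ^ 2 + Cmod t * Cmod a + Cmod a ^ 2)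
  + 2 / 25 * (Cmod t + Cmod a) + / 125.
Proof.
unfold radicand_slope; set (u := polar 1 theta).
assert (Hu : Cmod u = 1) by (apply Cmod_polar; lra).
pose proof (Cmod_triangle (u ^ 2 * (2 / 5 * (t ^ 2 + t * a + a ^ 2))
  + 2 / 25 * u ^ 3 * (t + a)) (u ^ 4 / 125))%C as T1.
pose proof (Cmod_triangle (u ^ 2 * (2 / 5 * (t ^ 2 + t * a + a ^ 2)))
  (2 / 25 * u ^ 3 * (t + a)))%C as T2.
pose proof (Cmod_triangle (t ^ 2 + t * a) (a ^ 2))%C as T3.
pose proof (Cmod_triangle (t ^ 2) (t * a))%C as T4.
pose proof (Cmod_triangle t a) as T5.
unfold Cdiv in *.
rewrite <- !RtoC_inv in * by lra.
rewrite !Cmod_mult, !Cmod_R, !Cmod_pow, Hu, !pow1 in *.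
rewrite !Rabs_pos_eq in * by lra; lra.
Qed.

(* Multiplied by [u^-3], the three terms lie in the right half-plane. *)
Lemma radicand_slope_neq_0 (theta T tau r s : R) :
  0 <= theta <= PI / 5 -> 0 < T -> 0 < r ->
  - theta / 4 <= tau <= 0 -> - theta / 4 <= s <= 0 ->
  radicand_slope (polar 1 theta) (polar T tau) (polar r s) <> 0%C.
Proof.
intros Hth HT Hr Htau Hs H; pose proof PI_RGT_0 as HPI.
apply (f_equal (proj (3 * theta))) in H; revert H.
replace (proj (3 * theta) 0%C) with 0 by (unfold proj; simpl; ring).
apply Rgt_not_eq.
assert (K : forall a b, 0 < a -> 3 * theta - PI / 2 < b < 3 * theta + PI / 2 ->
  0 < proj (3 * theta) (polar a b)).
{ intros a b Ha Hb; rewrite proj_polar; apply Rmult_lt_0_compat; [exact Ha|].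
  apply cos_gt_0; lra. }
replace (radicand_slope _ _ _) with
  (polar (2 / 5 * T ^ 2) (2 * theta + 2 * tau)
   + polar (2 / 5 * (T * r)) (2 * theta + tau + s)
   + polar (2 / 5 * r ^ 2) (2 * theta + 2 * s)
   + polar (2 / 25 * T) (3 * theta + tau)
   + polar (2 / 25 * r) (3 * theta + s) + polar (/ 125) (4 * theta))%C.
- rewrite !proj_plus.
  pose proof (pow_lt T 2 HT); pose proof (pow_lt r 2 Hr).
  do 5 (apply Rplus_lt_0_compat; [|apply K; nra]); apply K; nra.
- unfold radicand_slope; rewrite !polar_pow.
  rewrite <- (Rmult_1_r (/ 125)), <- (polar_scal (/ 125)).
  rewrite <- !(polar_scal (2 / 5)), <- !(polar_scal (2 / 25)).
  replace (polar (T ^ 2) (2 * theta + 2 * tau))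
    with (polar (1 ^ 2) (INR 2 * theta) * polar (T ^ 2) (INR 2 * tau))%C
    by (rewrite polar_mul; simpl INR; f_equal; ring).
  replace (polar (T * r) (2 * theta + tau + s))
    with (polar (1 ^ 2) (INR 2 * theta) * (polar T tau * polar r s))%C
    by (rewrite !polar_mul; simpl INR; f_equal; ring).
  replace (polar (r ^ 2) (2 * theta + 2 * s))
    with (polar (1 ^ 2) (INR 2 * theta) * polar (r ^ 2) (INR 2 * s))%C
    by (rewrite polar_mul; simpl INR; f_equal; ring).
  replace (polar T (3 * theta + tau))
    with (polar (1 ^ 3) (INR 3 * theta) * polar T tau)%C
    by (rewrite polar_mul; simpl INR; f_equal; ring).
  replace (polar r (3 * theta + s))
    with (polar (1 ^ 3) (INR 3 * theta) * polar r s)%C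
    by (rewrite polar_mul; simpl INR; f_equal; ring).
  replace (polar 1 (4 * theta)) with (polar (1 ^ 4) (INR 4 * theta))
    by (simpl INR; f_equal; ring).
  rewrite !RtoC_inv, !RtoC_div by lra.
  field.
Qed.

(* [T], [R], [U], [N] stand for the moduli of [t_k], [u + y_k], [u + y*] and
   of the difference of the two radicands; [e], [e'] for the successive errors. *)
Record step_bounds (r U R T N e e' : R) : Prop := {
  sb_T : 0 < T;
  sb_N0 : 0 <= N;
  sb_TR : T ^ 4 * R = r ^ 4 * U;
  sb_N : N * (0.97 * (T ^ 3 + T ^ 2 * r + T * r ^ 2 + r ^ 3) * R)
    <= r ^ 4 * e
       * (2 / 5 * (T ^ 2 + T * r + r ^ 2) + 2 / 25 * (T + r) + / 125);
  sb_e' : N <= 0.06 * (0.92 * (r + / 5)) ^ 5 ->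
    4.85 * (0.92 * (r + / 5)) ^ 4 * e' <= N }.

(** The first part says that the step reaches [y*] only from [y*]: equal radicands force [t = y*]
    because the slope does not vanish. This keeps all errors positive, as strict inequalities
    require. The second part passes from [y] to [t], from [t] to the radicand, and from there to the
    next iterate. *)
Lemma ystep_bounds (xi theta r s R d : R) (y : C) :
  0 < xi -> 0 <= theta <= PI / 5 -> 0 < r -> - theta / 4 <= s <= 0 ->
  (polar r s ^ 4 * (polar 1 theta + polar r s) = 2 * xi)%C ->
  0 < R -> 0 <= d <= theta -> (polar 1 theta + y)%C = polar R d ->
  (ystep xi theta y = polar r s -> y = polar r s) /\
  exists T N, step_bounds r (Cmod (polar 1 theta + polar r s)%C) R T N
    (Cmod (y - polar r s)%C) (Cmod (ystep xi theta y - polar r s)%C).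
Proof.
intros Hxi Hth Hr Hs E HR Hd Ey; pose proof PI_RGT_0 as HPI.
destruct (ystar_shift_polar _ _ _ _ Hxi Hr E) as (U & HU & EU & HUp).
destruct (ystar_fixed _ _ _ _ Hxi Hth Hr Hs E) as [Ft Fy].
destruct (ystep_sector xi theta R d y Hxi Hth HR Hd Ey)
  as (T & tau & P & nu & HT & Htau & Et & Ett & HP & Hnu & EV & EV5).
destruct (ystep_sector xi theta U (- (4 * s)) (polar r s) Hxi Hth HU
    ltac:(lra) HUp)
  as (T' & tau' & Q & mu & _ & _ & _ & _ & HQ & Hmu & EW & EW5).
rewrite Ft, Fy in *; clear T' tau' Ft.
set (u := polar 1 theta) in *; set (a := polar r s) in *.
set (t := tstep xi theta y) in *; set (y' := ystep xi theta y) in *.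
assert (ED : (polar P nu ^ 5 - polar Q mu ^ 5 = (t - a) * radicand_slope u t a)%C)
  by (rewrite EV5, EW5; apply radicand_minus).
assert (Eyy : (y' - a = polar P nu - polar Q mu)%C)
  by (rewrite <- EV, <- EW; ring).
assert (Hsl : radicand_slope u t a <> 0%C).
{ rewrite Et; apply radicand_slope_neq_0; lra. }
(* Both [t^4 (u + y)] and [a^4 (u + a)] equal [2 xi], so the error of [y] controls [t^4 - a^4]
   exactly. *)
assert (Et4 : ((t ^ 4 - a ^ 4) * (u + y) = a ^ 4 * (a - y))%C).
{ transitivity (t ^ 4 * (u + y) - a ^ 4 * (u + a) + a ^ 4 * (a - y))%C; [ring|].
  rewrite Ett, E; ring. }
assert (Ca : Cmod a = r) by (apply Cmod_polar; lra).
assert (Ct : Cmod t = T) by (rewrite Et; apply Cmod_polar; lra).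
assert (CR : Cmod (u + y)%C = R) by (rewrite Ey; apply Cmod_polar; lra).
assert (CU : Cmod (u + a)%C = U) by (rewrite HUp; apply Cmod_polar; lra).
split.
- intros Hy.
  assert (Z : ((t - a) * radicand_slope u t a = 0)%C).
  { rewrite <- ED; replace (polar P nu) with (polar Q mu); [ring|].
    rewrite <- EV, <- EW, Hy; reflexivity. }
  assert (Hta : (t - a)%C = 0%C) by exact (Cmult_integral_l _ _ Hsl Z).
  assert (Hta' : t = a) by (transitivity (t - a + a)%C; [ring|rewrite Hta; ring]).
  rewrite Hta' in Et4.
  assert (Z2 : ((a - y) * a ^ 4 = 0)%C).
  { transitivity (a ^ 4 * (a - y))%C; [ring|]; rewrite <- Et4; ring. }
  assert (Ha4 : (a ^ 4)%C <> 0%C).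
  { unfold a; rewrite polar_pow; apply polar_neq_0, pow_lt; exact Hr. }
  assert (Hay : (a - y)%C = 0%C) by exact (Cmult_integral_l _ _ Ha4 Z2).
  transitivity (a - (a - y))%C; [ring|rewrite Hay; ring].
- exists T, (Cmod (polar P nu ^ 5 - polar Q mu ^ 5)%C); split.
  + exact HT.
  + apply Cmod_ge_0.
  + rewrite CU, EU.
    apply (f_equal Cmod) in Ett.
    rewrite Cmod_mult, Cmod_pow, Ct, CR, <- RtoC_mult, Cmod_R in Ett.
    rewrite Rabs_pos_eq in Ett by lra; exact Ett.
  + pose proof (fourth_power_gap theta T tau r s Hth HT Hr Htau Hs) as G.
    rewrite <- Et in G; fold a in G.
    apply (f_equal Cmod) in Et4; rewrite !Cmod_mult, CR, Cmod_pow, Ca in Et4.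
    rewrite ED, Cmod_mult.
    pose proof (radicand_slope_le theta t a) as L; fold u in L.
    rewrite Ct, Ca in L.
    replace (Cmod (y - a)%C) with (Cmod (a - y)%C)
      by (rewrite <- Cmod_opp; f_equal; ring).
    rewrite <- Et4.
    pose proof (Cmod_ge_0 (t - a)%C); pose proof (Cmod_ge_0 (radicand_slope u t a)).
    pose proof (Cmod_ge_0 (t ^ 4 - a ^ 4)%C).
    set (A := 0.97 * _) in *; set (B := _ + / 125) in *.
    apply Rle_trans with (Cmod (t - a)%C * A * R * Cmod (radicand_slope u t a));
      [right; ring|].
    apply Rmult_le_compat; try lra.
    * unfold A.
      pose proof (pow_lt T 3 HT); pose proof (pow_lt T 2 HT).
      pose proof (pow_lt r 3 Hr); pose proof (pow_lt r 2 Hr).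
      assert (0 <= T ^ 2 * r) by nra; assert (0 <= T * r ^ 2) by nra.
      apply Rmult_le_pos; [apply Rmult_le_pos|]; lra.
    * apply Rmult_le_compat_r; lra.
  (* Replacing [Q = |y* + u/5|] by this lower bound strengthens the hypothesis of [fifth_power_gap]
     and weakens its conclusion. *)
  + assert (HWQ : 0.92 * (r + / 5) <= Q).
    { replace Q with (Cmod (a + u / 5)%C)
        by (rewrite EW; apply Cmod_polar; lra).
      replace (u / 5)%C with (polar (/ 5) theta).
      - apply Cmod_polar_add_ge; lra.
      - rewrite <- (Rmult_1_r (/ 5)), <- polar_scal, RtoC_inv by lra.
        fold u; field. }
    set (W := 0.92 * (r + / 5)) in *.
    assert (HW : 0 <= W) by (unfold W; lra).
    pose proof (pow_incr W Q 4 (conj HW HWQ)).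
    pose proof (pow_incr W Q 5 (conj HW HWQ)).
    intros HN; rewrite Eyy.
    apply Rle_trans with (2 := fifth_power_gap P nu Q mu HP HQ ltac:(lra)
      ltac:(lra) ltac:(lra)).
    apply Rmult_le_compat_r; [apply Cmod_ge_0|lra].
Qed.

(** Each new [u + y] is the sum of [y + u/5] and [4 u / 5], both with arguments in [[0, theta]]. *)
Lemma yseq_sector (xi theta : R) (k : nat) :
  0 < xi -> 0 <= theta <= PI / 5 ->
  exists R d, 0 < R /\ 0 <= d <= theta /\
    (polar 1 theta + yseq xi theta k)%C = polar R d.
Proof.
intros Hxi Hth; pose proof PI_RGT_0 as HPI; induction k as [|k IH].
- destruct (polar_add (Rpower (xi / alpha) (2 / 9)) 0 1 theta)
    as (R & d & HR & Hd & _ & E); [apply exp_pos|lra..|].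
  exists R, d; split; [exact HR|split; [exact Hd|]].
  simpl yseq; rewrite RtoC_polar, Cplus_comm; exact E.
- destruct IH as (R & d & HR & Hd & E).
  destruct (ystep_sector xi theta R d _ Hxi Hth HR Hd E)
    as (T & tau & P & nu & _ & _ & _ & _ & HP & Hnu & EV & _).
  destruct (polar_add P nu (4 / 5) theta) as (R' & d' & HR' & Hd' & _ & E');
    [lra..|].
  exists R', d'; split; [exact HR'|split; [lra|]].
  simpl yseq; rewrite <- E', <- EV, <- (Rmult_1_r (4 / 5)), <- polar_scal.
  rewrite RtoC_div by lra; field.
Qed.

(** * Contraction for small errors *)

(** As [U >= 0.92], the error is at most [0.0047 U], so [R] is within half a percent of [U], and [T]
    within half a percent of [r]. What remains is a polynomial inequality in [r] alone. *)
Lemma step_contracts (r U R T N e e' : R) :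
  0 < r -> step_bounds r U R T N e e' -> 0.92 * (1 + r) <= U ->
  U - e <= R <= U + e -> 0 < e <= 0.00432 -> e' < / 15.44 * e.
Proof.
intros Hr [HT HN0 HTR HN He'] HU HR He.
pose proof (pow_lt r 2 Hr) as Hr2; pose proof (pow_lt r 3 Hr) as Hr3.
pose proof (pow_lt r 4 Hr) as Hr4; pose proof (pow_lt T 2 HT) as HT2.
pose proof (pow_lt T 4 HT) as HT4.
assert (HRl : 0.9953 * U <= R) by lra.
assert (HRu : R <= 1.0047 * U) by lra.
assert (HTl : 0.995 * r <= T).
{ destruct (Rle_dec (0.995 * r) T) as [|H]; [assumption|exfalso].
  pose proof (pow_incr T (0.995 * r) 4 ltac:(lra)) as H4.
  rewrite Rpow_mult_distr in H4.
  assert (T ^ 4 * R <= 0.9802 * r ^ 4 * (1.0047 * U))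
    by (apply Rmult_le_compat; lra).
  assert (0 < r ^ 4 * U) by (apply Rmult_lt_0_compat; lra).
  lra. }
assert (HTu : T <= 1.005 * r).
{ destruct (Rle_dec T (1.005 * r)) as [|H]; [assumption|exfalso].
  pose proof (pow_incr (1.005 * r) T 4 ltac:(lra)) as H4.
  rewrite Rpow_mult_distr in H4.
  assert (1.02 * r ^ 4 * (0.9953 * U) <= T ^ 4 * R)
    by (apply Rmult_le_compat; lra).
  assert (0 < r ^ 4 * U) by (apply Rmult_lt_0_compat; lra).
  lra. }
clear HTR.
assert (T2u : T ^ 2 <= 1.011 * r ^ 2) by nra.
assert (T2l : 0.99 * r ^ 2 <= T ^ 2) by nra.
assert (T3l : 0.985 * r ^ 3 <= T ^ 3) by nra.
assert (Hb : 2 / 5 * (T ^ 2 + T * r + r ^ 2) + 2 / 25 * (T + r) + / 125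
  <= 1.011 * (1.2 * r ^ 2 + 0.16 * r + 0.008)) by nra.
assert (Hc : r ^ 3 * (3.52 * (1 + r))
  <= 0.97 * (T ^ 3 + T ^ 2 * r + T * r ^ 2 + r ^ 3) * R).
{ apply Rle_trans with (0.97 * (3.969 * r ^ 3) * (0.9953 * (0.92 * (1 + r))));
    [nra|].
  apply Rmult_le_compat; [nra|nra| |lra].
  assert (0.99 * r ^ 2 * r <= T ^ 2 * r) by nra.
  assert (0.995 * r * r ^ 2 <= T * r ^ 2) by nra.
  lra. }
assert (HN1 : N * (3.52 * (1 + r))
  <= r * e * (1.011 * (1.2 * r ^ 2 + 0.16 * r + 0.008))).
{ apply Rmult_le_reg_l with (r ^ 3); [exact Hr3|].
  apply Rle_trans with (N * (0.97 * (T ^ 3 + T ^ 2 * r + T * r ^ 2 + r ^ 3) * R)).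
  - replace (r ^ 3 * (N * _)) with (N * (r ^ 3 * (3.52 * (1 + r)))) by ring.
    apply Rmult_le_compat_l; assumption.
  - apply Rle_trans with (1 := HN).
    replace (r ^ 3 * _) with
      (r ^ 4 * e * (1.011 * (1.2 * r ^ 2 + 0.16 * r + 0.008))) by ring.
    apply Rmult_le_compat_l; [nra|exact Hb]. }
clear HN Hc Hb.
set (w := r + / 5) in *.
assert (Hw : 0.2 < w) by (unfold w; lra).
pose proof (pow_lt w 4 ltac:(lra)) as Hw4.
(* Here [15.62] exceeds [15.45 * 1.011] and [12.2] is below [3.47 * 3.52], where [3.47] is below
   [4.85 * 0.92^4] and [15.45] slightly exceeds [K]. The only negative coefficient of the difference
   is that of [r^3]; a quadratic factor of negative discriminant absorbs it. *)
assert (Poly : 15.62 * r * (1.2 * r ^ 2 + 0.16 * r + 0.008)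
  < 12.2 * (1 + r) * w ^ 4).
{ unfold w.
  assert (0 <= r ^ 2 * (22 * r ^ 2 - 6.1 * r + 0.82))
    by (apply Rmult_le_pos; nra).
  assert (0 < r ^ 5) by (apply pow_lt; exact Hr).
  replace (r + / 5) with (r + 0.2) by lra.
  lra. }
rewrite !Rpow_mult_distr in He'.
assert (HN2 : N * 15.45 < 3.47 * w ^ 4 * e).
{ apply Rmult_lt_reg_r with (3.52 * (1 + r)); [lra|].
  apply Rle_lt_trans with (e * (15.62 * r * (1.2 * r ^ 2 + 0.16 * r + 0.008)));
    [nra|].
  apply Rlt_le_trans with (e * (12.2 * (1 + r) * w ^ 4));
    [apply Rmult_lt_compat_l; lra|].
  assert (0 < e * (1 + r) * w ^ 4) by (repeat apply Rmult_lt_0_compat; lra).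
  lra. }
(* From [w > 0.2] comes [e <= 0.00432 <= 0.0216 w], which turns the bound on [N] into one of degree
   5 in [w]. *)
assert (HN3 : N <= 0.06 * (0.92 ^ 5 * w ^ 5)).
{ assert (w ^ 4 * e <= w ^ 4 * (0.0216 * w))
    by (apply Rmult_le_compat_l; lra).
  replace (w ^ 5) with (w ^ 4 * w) by ring; lra. }
specialize (He' HN3).
apply Rmult_lt_reg_l with (3.474 * w ^ 4); [lra|].
assert (e' <= 0 \/ 0 < e') as [Hn|Hp] by lra.
- assert (0 < w ^ 4 * e) by (apply Rmult_lt_0_compat; lra).
  nra.
- assert (0 < w ^ 4 * e') by (apply Rmult_lt_0_compat; lra).
  lra.
Qed.

(** * The first step: estimates in real variables *)

Lemma step_bounds_T_le (r U R T N e e' : R) :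
  0 < r -> 0 < U <= R -> step_bounds r U R T N e e' -> T <= r.
Proof.
intros Hr HU [HT HN0 HTR HN He'].
destruct (Rle_dec T r) as [|H]; [assumption|exfalso].
pose proof (pow_lt r 4 Hr).
assert (r ^ 4 < T ^ 4).
{ assert (r ^ 2 < T ^ 2) by nra; assert (0 < r ^ 2) by nra.
  replace (r ^ 4) with (r ^ 2 * r ^ 2) by ring.
  replace (T ^ 4) with (T ^ 2 * T ^ 2) by ring; nra. }
assert (r ^ 4 * U < T ^ 4 * R)
  by (apply Rle_lt_trans with (r ^ 4 * R); [nra|nra]).
lra.
Qed.

(** For a possibly large error, [U <= R] still gives [T <= r]. Here [k] measures the cofactor of
    [fourth_power_gap] against [r^3] and [a] the error against [R]; only the ratio [a / k]
    enters. *)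
Lemma step_bounds_cubic (r U R T N e e' k a : R) :
  0 < r -> 0 < U <= R -> step_bounds r U R T N e e' ->
  0 < k -> k * r ^ 3 <= T ^ 3 + T ^ 2 * r + T * r ^ 2 + r ^ 3 ->
  0 <= e <= a * R ->
  N * (0.97 * k) <= a * r * (1.2 * r ^ 2 + 0.16 * r + 0.008).
Proof.
intros Hr HU HB Hk Hc He; pose proof (step_bounds_T_le _ _ _ _ _ _ _ Hr HU HB).
destruct HB as [HT HN0 HTR HN He'].
pose proof (pow_lt r 3 Hr) as Hr3; pose proof (pow_lt r 4 Hr) as Hr4.
assert (Hb : 2 / 5 * (T ^ 2 + T * r + r ^ 2) + 2 / 25 * (T + r) + / 125
  <= 1.2 * r ^ 2 + 0.16 * r + 0.008) by nra.
set (b := 1.2 * r ^ 2 + _ + _) in *.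
assert (0 < b) by (unfold b; nra).
set (c := T ^ 3 + _ + _ + _) in *.
apply Rmult_le_reg_r with (r ^ 3 * R); [apply Rmult_lt_0_compat; lra|].
apply Rle_trans with (N * (0.97 * c * R)).
- replace (N * (0.97 * k) * (r ^ 3 * R)) with (N * (0.97 * (k * r ^ 3) * R)) by ring.
  apply Rmult_le_compat_l; [exact HN0|]; apply Rmult_le_compat_r; lra.
- apply Rle_trans with (1 := HN).
  apply Rle_trans with (r ^ 4 * (a * R) * b); [|right; ring].
  apply Rmult_le_compat; try lra; [nra| |apply Rmult_le_compat_l; lra].
  assert (0 < T * r) by nra; nra.
Qed.

(** Here [Y] is [y_0] and [s] is minus the argument of [y*]. The bound on [N] grows like [r^3] and
    the target like [r^4]. Up to [r = 1000], [Y <= 2 r] keeps [T] above [0.82 r]; beyond, the size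
    of [r] makes up for having only [T > 0]. The target [0.01494] is just below
    [0.0043 * 4.85 * 0.92^4]. *)
Lemma first_step_far (r U R T N e e' Y s : R) :
  16 <= r -> 0.92 * (1 + r) <= U <= R -> step_bounds r U R T N e e' ->
  r <= Y -> 0.92 * (1 + Y) <= R <= 1 + Y -> (r <= 1000 -> Y <= 2 * r) ->
  0 <= e <= (Y - r) + s * r -> 0 <= s -> s * (4 + 4.4 * r) <= 0.63 ->
  N <= 0.01494 * (r + / 5) ^ 4.
Proof.
intros Hr HU HB HY HR HY2 He Hs Hs'.
pose proof (step_bounds_T_le r U R T N e e' ltac:(lra) ltac:(lra) HB) as HTr.
assert (Hw : r ^ 4 <= (r + / 5) ^ 4) by (apply pow_incr; lra).
pose proof (pow_lt r 3 ltac:(lra)) as Hr3; pose proof (pow_lt r 4 ltac:(lra)).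
assert (Hr2 : 0 < r ^ 2) by nra.
assert (Hsr : s * r <= 0.144) by nra.
destruct (Rle_dec r 1000) as [H1000|H1000].
- specialize (HY2 H1000).
  assert (HT : 0 < T) by apply HB.
  assert (HTl : 0.82 * r <= T).
  { destruct (Rle_dec (0.82 * r) T) as [|HN]; [assumption|exfalso].
    pose proof (pow_incr T (0.82 * r) 4 ltac:(lra)) as H4.
    rewrite Rpow_mult_distr in H4.
    assert (HTR : T ^ 4 * R = r ^ 4 * U) by apply HB.
    pose proof (pow_lt T 4 HT).
    assert (T ^ 4 * R <= 0.4522 * r ^ 4 * (1 + 2 * r))
      by (apply Rmult_le_compat; lra).
    assert (r ^ 4 * (0.92 * (1 + r)) <= r ^ 4 * U)
      by (apply Rmult_le_compat_l; lra).
    nra. }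
  assert (T2 : 0.672 * r ^ 2 <= T ^ 2) by nra.
  assert (T3 : 0.551 * r ^ 3 <= T ^ 3) by nra.
  pose proof (step_bounds_cubic r U R T N e e' 3.04 0.555
    ltac:(lra) ltac:(lra) HB ltac:(lra) ltac:(nra) ltac:(lra)) as K.
  assert (16 * r ^ 3 <= r ^ 4) by nra.
  assert (16 * r ^ 2 <= r ^ 3) by nra.
  nra.
- assert (HT : 0 < T) by apply HB.
  pose proof (pow_lt T 3 HT); pose proof (pow_lt T 2 HT).
  assert (0 <= T ^ 2 * r) by nra; assert (0 <= T * r ^ 2) by nra.
  pose proof (step_bounds_cubic r U R T N e e' 1 1.1
    ltac:(lra) ltac:(lra) HB ltac:(lra) ltac:(lra) ltac:(lra)) as K.
  assert (1000 * r ^ 3 <= r ^ 4) by nra.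
  assert (1000 * r ^ 2 <= r ^ 3) by nra.
  nra.
Qed.

(** The error of [y_0] is bounded by its radial part [Y - r] and the arc [s * r]. The second claim
    is the hypothesis of [sb_e']; the first then yields the error bound [0.0043]. *)
Lemma first_step_near (r U R T N e e' Y s : R) :
  0 < r <= 16 -> 0.92 * (1 + r) <= U <= R -> R <= U + e ->
  step_bounds r U R T N e e' ->
  0 <= e <= (Y - r) + s * r -> 0 <= s -> s * (4 + 4.4 * r) <= 0.63 ->
  30.7 * (Y - r) <= r ^ 2 + 1 - 1.414 * r ->
  N <= 0.0043 * (4.85 * (0.92 * (r + / 5)) ^ 4) /\
  N <= 0.06 * (0.92 * (r + / 5)) ^ 5.
Proof.
intros Hr HU HRe HB He Hs Hs' HY.
pose proof (step_bounds_T_le r U R T N e e' ltac:(lra) ltac:(lra) HB) as HTr.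
assert (HT : 0 < T) by apply HB.
assert (He2 : e <= 2 * U) by nra.
(* [T / r = (U / R)^(1/4) >= (1 + 4 v)^(-1/4) >= 1 - v]. *)
set (v := e / (4 * U)).
assert (Ev : e = 4 * U * v) by (unfold v; field; lra).
assert (Hv : 0 <= v <= / 2).
{ split; [apply Rdiv_le_0_compat; lra|].
  apply Rmult_le_reg_l with (4 * U); lra. }
assert (HTl : (1 - v) * r <= T).
{ destruct (Rle_dec ((1 - v) * r) T) as [|HN]; [assumption|exfalso].
  assert (HTR : T ^ 4 * R = r ^ 4 * U) by apply HB.
  assert (H4 : T ^ 4 < ((1 - v) * r) ^ 4).
  { assert (T ^ 2 < ((1 - v) * r) ^ 2) by nra; assert (0 < T ^ 2) by nra.
    replace (T ^ 4) with (T ^ 2 * T ^ 2) by ring.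
    replace (((1 - v) * r) ^ 4) with (((1 - v) * r) ^ 2 * ((1 - v) * r) ^ 2)
      by ring; nra. }
  rewrite Rpow_mult_distr in H4.
  pose proof (pow_lt r 4 ltac:(lra)) as Hr4.
  assert (B : (1 - v) ^ 4 * (1 + 4 * v) <= 1).
  { assert (0 <= v ^ 2 * (10 - 20 * v + 15 * v ^ 2 - 4 * v ^ 3)); [|lra].
    apply Rmult_le_pos; nra. }
  assert (T ^ 4 * R <= T ^ 4 * (U * (1 + 4 * v))).
  { apply Rmult_le_compat_l; [apply pow_le; lra|lra]. }
  assert (T ^ 4 * (U * (1 + 4 * v)) < (1 - v) ^ 4 * r ^ 4 * (U * (1 + 4 * v))).
  { apply Rmult_lt_compat_r; [nra|exact H4]. }
  assert (r ^ 4 * U * ((1 - v) ^ 4 * (1 + 4 * v)) <= r ^ 4 * U * 1).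
  { apply Rmult_le_compat_l; [nra|exact B]. }
  lra. }
assert (Hcub : (4 - 6 * v) * r ^ 3 <= T ^ 3 + T ^ 2 * r + T * r ^ 2 + r ^ 3).
{ pose proof (pow_incr ((1 - v) * r) T 2 ltac:(nra)) as P2.
  pose proof (pow_incr ((1 - v) * r) T 3 ltac:(nra)) as P3.
  rewrite Rpow_mult_distr in P2, P3.
  pose proof (pow_lt r 2 ltac:(lra)); pose proof (pow_lt r 3 ltac:(lra)).
  assert (1 - 2 * v <= (1 - v) ^ 2) by nra.
  assert (1 - 3 * v <= (1 - v) ^ 3) by nra.
  assert ((1 - 2 * v) * r ^ 2 * r <= T ^ 2 * r) by nra.
  assert ((1 - v) * r * r ^ 2 <= T * r ^ 2) by nra.
  assert ((1 - 3 * v) * r ^ 3 <= T ^ 3) by nra.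
  lra. }
assert (HeR : e <= 4 * v * R) by nra.
pose proof (step_bounds_cubic r U R T N e e' (4 - 6 * v) (4 * v)
  ltac:(lra) ltac:(lra) HB ltac:(lra) Hcub ltac:(lra)) as K.
set (b := 1.2 * r ^ 2 + 0.16 * r + 0.008) in *.
assert (Hb : 0 < b) by (unfold b; nra).
assert (K2 : N * (0.97 * (4 * U - 1.5 * e)) <= r * e * b).
{ replace (N * _) with (U * (N * (0.97 * (4 - 6 * v)))) by (rewrite Ev; lra).
  replace (r * e * b) with (U * (4 * v * r * b)) by (rewrite Ev; ring).
  apply Rmult_le_compat_l; lra. }
clear K HeR Hcub HTl HTr.
assert (HN0 : 0 <= N) by apply HB.
clear Ev Hv v HB.
set (D := 4 + 4.4 * r) in *.
(* [M / D] bounds [e]; both claims become polynomial inequalities in [r]. *)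
set (M := (r ^ 2 + 1 - 1.414 * r) / 30.7 * D + 0.63 * r).
assert (HM : e * D <= M) by (unfold M, D in *; nra).
assert (HD : 0 < D) by (unfold D; lra).
assert (K3 : N * (0.97 * (3.68 * (1 + r) * D - 1.5 * M)) <= r * M * b).
{ apply Rle_trans with (N * (0.97 * (4 * U - 1.5 * e)) * D).
  - rewrite (Rmult_assoc N _ D); apply Rmult_le_compat_l; [exact HN0|].
    assert (0.92 * (1 + r) * D <= U * D) by (apply Rmult_le_compat_r; lra).
    lra.
  - apply Rle_trans with (r * e * b * D); [apply Rmult_le_compat_r; lra|].
    replace (r * e * b * D) with (r * b * (e * D)) by ring.
    replace (r * M * b) with (r * b * M) by ring.
    apply Rmult_le_compat_l; [nra|exact HM]. }
assert (HM2 : 0 < 3.68 * (1 + r) * D - 1.5 * M).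
{ unfold M, D; nra. }
assert (Close : forall Z,
  r * M * b <= Z * (0.97 * (3.68 * (1 + r) * D - 1.5 * M)) -> N <= Z).
{ intros Z HZ.
  apply Rmult_le_reg_r with (0.97 * (3.68 * (1 + r) * D - 1.5 * M)); lra. }
clear K2 K3 HM.
assert (P0 : 0 < r ^ 2) by (apply pow_lt; lra).
assert (P1 : 0 < r ^ 3) by (apply pow_lt; lra).
assert (0 <= r ^ 4) by (apply pow_le; lra).
assert (0 <= r ^ 5) by (apply pow_le; lra).
assert (0 <= r ^ 6) by (apply pow_le; lra).
assert (C4 : N <= 0.0043 * (4.85 * (0.92 * (r + / 5)) ^ 4)).
{ apply Close; unfold M, D, b.
  assert (0 <= r ^ 3 * (0.03 - 0.082 * r + 0.68 * r ^ 2))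
    by (apply Rmult_le_pos; nra).
  (* The term [- 1.5 * M] makes the coefficient of [r^7] negative; [r <= 16] trades it for one of
     [r^6]. *)
  assert (0 <= r ^ 6 * (16 - r)) by (apply Rmult_le_pos; [apply pow_le|]; lra).
  replace (r + / 5) with (r + 0.2) by lra.
  lra. }
split; [exact C4|].
(* For [r > 1] the second claim follows from the first, since
   [0.0043 * 4.85 < 0.06 * 0.92 * (r + 1/5)]; for small [r] it is checked directly. *)
destruct (Rle_dec r 1) as [Hr1|Hr1].
- apply Close; unfold M, D, b.
  assert (0 <= r ^ 7 * (1 - r)) by (apply Rmult_le_pos; [apply pow_le|]; lra).
  assert (0 <= r ^ 7) by (apply pow_le; lra).
  replace (r + / 5) with (r + 0.2) by lra.
  lra.
- apply Rle_trans with (1 := C4).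
  assert (0 <= (0.92 * (r + / 5)) ^ 4) by (apply pow_le; lra).
  change ((0.92 * (r + / 5)) ^ 5)
    with (0.92 * (r + / 5) * (0.92 * (r + / 5)) ^ 4); nra.
Qed.

(** * Position of the distinguished root and of the initial value *)

Lemma Cmod_unit_add_sqr (theta r s : R) :
  Cmod (polar 1 theta + polar r s)%C ^ 2 = 1 + r ^ 2 + 2 * r * cos (theta - s).
Proof.
unfold Cmod; rewrite pow2_sqrt.
- unfold polar, Cplus; simpl fst; simpl snd; rewrite cos_minus.
  pose proof (sin2_cos2 theta) as E1; pose proof (sin2_cos2 s) as E2.
  unfold Rsqr in E1, E2.
  transitivity ((sin theta * sin theta + cos theta * cos theta)
    + r ^ 2 * (sin s * sin s + cos s * cos s)
    + 2 * r * (cos theta * cos s + sin theta * sin s)); [ring|].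
  rewrite E1, E2; ring.
- apply Rplus_le_le_0_compat; apply pow2_ge_0.
Qed.

Lemma Cmod_chord_le (r s : R) :
  0 <= r -> s <= 0 -> Cmod (r - polar r s)%C <= - s * r.
Proof.
intros Hr Hs; unfold Cmod.
rewrite <- (sqrt_pow2 (- s * r)) by nra; apply sqrt_le_1_alt.
unfold polar, Cminus, Cplus, Copp, RtoC; simpl fst; simpl snd.
pose proof (cos_ge_quadratic (- s) ltac:(lra)) as H; rewrite cos_neg in H.
pose proof (sin2_cos2 s) as E; unfold Rsqr in E.
apply Rle_trans with (r ^ 2 * (1 - 2 * cos s + (sin s * sin s + cos s * cos s)));
  [right; ring|].
rewrite E; replace ((- s * r) ^ 2) with (r ^ 2 * s ^ 2) by ring.
apply Rmult_le_compat_l; [apply pow2_ge_0|]; lra.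
Qed.

Lemma Bernoulli_homogeneous (n : nat) (r h : R) :
  0 <= r -> 0 <= h -> r ^ S n + INR (S n) * r ^ n * h <= (r + h) ^ S n.
Proof.
intros Hr Hh; induction n as [|n IH].
- simpl; lra.
- change ((r + h) ^ S (S n)) with ((r + h) * (r + h) ^ S n).
  apply Rle_trans with ((r + h) * (r ^ S n + INR (S n) * r ^ n * h)).
  + rewrite (S_INR (S n)).
    change (r ^ S (S n)) with (r * r ^ S n); change (r ^ S n) with (r * r ^ n).
    assert (0 <= INR (S n) * r ^ n * h * h).
    { repeat apply Rmult_le_pos; try assumption; [apply pos_INR|].
      apply pow_le; exact Hr. }
    lra.
  + apply Rmult_le_compat_l; lra.
Qed.

(* The component of [u + y*] orthogonal to its own direction [-4 s] vanishes:
   [sin (theta + 4 s) + r sin (5 s) = 0]. *)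
Lemma ystar_arg_le (theta r s U : R) :
  0 <= theta <= PI / 5 -> 0 < r -> - theta / 4 <= s <= 0 ->
  (polar 1 theta + polar r s)%C = polar U (- (4 * s)) ->
  - s * (4 + 4.4 * r) <= 0.63.
Proof.
intros Hth Hr Hs E; pose proof PI_lt_315; pose proof PI_RGT_0.
apply (f_equal (proj (PI / 2 - 4 * s))) in E.
rewrite proj_plus, !proj_polar in E.
replace (theta - (PI / 2 - 4 * s)) with (- (PI / 2 - (theta + 4 * s))) in E by ring.
replace (s - (PI / 2 - 4 * s)) with (- (PI / 2 - 5 * s)) in E by ring.
replace (- (4 * s) - (PI / 2 - 4 * s)) with (- (PI / 2)) in E by ring.
rewrite !cos_neg, !cos_shift, cos_PI2 in E.
assert (H1 : sin (theta + 4 * s) <= theta + 4 * s).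
{ destruct (Req_dec (theta + 4 * s) 0) as [->|]; [rewrite sin_0; lra|].
  apply Rlt_le, sin_lt_x; lra. }
assert (H2 : 4.4 * - s <= sin (5 * - s)).
{ apply Rle_trans with (2 := sin_ge_cubic (5 * - s) ltac:(lra)).
  assert (s ^ 2 <= 0.025) by nra.
  assert (0 <= - s * (0.6 - 125 / 6 * s ^ 2)) by (apply Rmult_le_pos; lra).
  lra. }
replace (5 * - s) with (- (5 * s)) in H2 by ring; rewrite sin_neg in H2.
nra.
Qed.

(** Everything follows from [(2 + sqrt 2) * Y^9 = r^8 * U^2]. The lower bound on [U^2] is at least
    [(2 + sqrt 2) * r] because [r^2 + 1 >= 2 r], whence [r <= Y]; the upper bounds on [Y] use
    [U <= 1 + r]. The last fact separates [y_0] from [y*] when [theta = 0]. *)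
Lemma y0_facts (xi r U : R) :
  0 < xi -> 0 < r -> 0 < U -> r ^ 4 * U = 2 * xi ->
  r ^ 2 + 1 + sqrt 2 * r <= U ^ 2 -> U <= 1 + r ->
  let Y := Rpower (xi / alpha) (2 / 9) in
  r <= Y /\ 30.7 * (Y - r) <= r ^ 2 + 1 - 1.414 * r /\
  (16 <= r <= 1000 -> Y <= 2 * r) /\ (U = 1 + r -> Y <> r).
Proof.
intros Hxi Hr HU HrU HU2 HUr Y.
assert (HY : 0 < Y) by apply exp_pos.
set (q := sqrt 2) in *.
assert (Hq2 : q * q = 2) by (apply sqrt_sqrt; lra).
assert (Hq0 : 0 <= q) by apply sqrt_pos.
assert (Hq : 1.414 < q < 1.415) by (split; nra).
assert (Ha : 0 < alpha) by (apply sqrt_lt_R0; fold q; lra).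
assert (Ha2 : alpha * alpha = (2 + q) / 4) by (apply sqrt_sqrt; fold q; lra).
assert (EY : (2 + q) * Y ^ 9 = r ^ 8 * U ^ 2).
{ assert (E : Y ^ 9 = (xi / alpha) ^ 2).
  { unfold Y; rewrite <- Rpower_pow by apply exp_pos.
    rewrite Rpower_mult, <- Rpower_pow by (apply Rdiv_lt_0_compat; lra).
    f_equal; simpl INR; field. }
  rewrite E; replace (r ^ 8 * U ^ 2) with ((r ^ 4 * U) ^ 2) by ring; rewrite HrU.
  replace ((xi / alpha) ^ 2) with (xi ^ 2 / (alpha * alpha)) by (field; lra).
  rewrite Ha2; field; lra. }
pose proof (pow_lt r 8 Hr) as H8.
assert (HYr : r <= Y).
{ destruct (Rle_dec r Y) as [|N]; [assumption|exfalso].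
  assert (Y ^ 8 <= r ^ 8) by (apply pow_incr; lra).
  assert (Y ^ 9 < r ^ 8 * r).
  { change (Y ^ 9) with (Y * Y ^ 8); apply Rle_lt_trans with (Y * r ^ 8).
    - apply Rmult_le_compat_l; lra.
    - rewrite Rmult_comm; apply Rmult_lt_compat_l; lra. }
  assert (r ^ 8 * ((2 + q) * r) <= r ^ 8 * U ^ 2)
    by (apply Rmult_le_compat_l; pose proof (pow2_ge_0 (r - 1)); lra).
  assert ((2 + q) * Y ^ 9 < (2 + q) * (r ^ 8 * r))
    by (apply Rmult_lt_compat_l; lra).
  lra. }
split; [exact HYr|split; [|split]].
(* Bernoulli gives [(2 + sqrt 2) * (r + 9 (Y - r)) <= U^2 <= (1 + r)^2], and [30.7] is just below
   [9 * 3.412]. *)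
- pose proof (Bernoulli_homogeneous 8 r (Y - r) ltac:(lra) ltac:(lra)) as B.
  replace (r + (Y - r)) with Y in B by ring.
  replace (INR 9) with 9 in B by (simpl; ring).
  change (r ^ 9) with (r * r ^ 8) in B.
  assert (B2 : r ^ 8 * ((2 + q) * (r + 9 * (Y - r))) <= r ^ 8 * U ^ 2) by nra.
  apply Rmult_le_reg_l in B2; [|exact H8].
  assert (U ^ 2 <= (1 + r) ^ 2) by (apply pow_incr; lra).
  assert (3.412 * (9 * (Y - r)) <= (2 + q) * (9 * (Y - r)))
    by (apply Rmult_le_compat_r; lra).
  nra.
- intros Hr1; destruct (Rle_dec Y (2 * r)) as [|N]; [assumption|exfalso].
  assert (B : (2 * r) ^ 9 <= Y ^ 9) by (apply pow_incr; lra).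
  rewrite Rpow_mult_distr in B; change (r ^ 9) with (r * r ^ 8) in B.
  assert (U ^ 2 <= (1 + r) ^ 2) by (apply pow_incr; lra).
  assert (U ^ 2 < 1024 * r) by nra.
  assert (r ^ 8 * U ^ 2 < r ^ 8 * (1024 * r)) by (apply Rmult_lt_compat_l; lra).
  assert ((2 + q) * (2 ^ 9 * (r * r ^ 8)) <= (2 + q) * Y ^ 9)
    by (apply Rmult_le_compat_l; lra).
  assert (0 <= q * (r * r ^ 8)) by (repeat apply Rmult_le_pos; lra).
  lra.
- intros HU1 E; rewrite E, HU1 in EY; change (r ^ 9) with (r * r ^ 8) in EY.
  assert (E2 : r ^ 8 * ((1 + r) ^ 2 - (2 + q) * r) = 0) by lra.
  apply Rmult_integral in E2; destruct E2; [lra|nra].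
Qed.

Lemma first_step_bound (xi theta r s : R) :
  0 < xi -> 0 <= theta <= PI / 5 -> 0 < r -> - theta / 4 <= s <= 0 ->
  (0 < theta -> s < 0) ->
  (polar r s ^ 4 * (polar 1 theta + polar r s) = 2 * xi)%C ->
  yseq xi theta 0 <> polar r s /\
  Cmod (yseq xi theta 1 - polar r s)%C <= 0.0043.
Proof.
intros Hxi Hth Hr Hs Hs0 E; pose proof PI_RGT_0 as HPI.
destruct (ystar_shift_polar _ _ _ _ Hxi Hr E) as (U & HU & HrU & EU).
assert (CU : Cmod (polar 1 theta + polar r s)%C = U)
  by (rewrite EU; apply Cmod_polar; lra).
pose proof (ystar_arg_le _ _ _ _ Hth Hr Hs EU) as Harg.
pose proof (Cmod_unit_add_sqr theta r s) as U2; rewrite CU in U2.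
pose proof (Cmod_polar_add_ge 1 theta r s ltac:(lra) ltac:(lra) ltac:(lra)) as Ul.
pose proof (Cmod_triangle (polar 1 theta) (polar r s)) as Uu.
rewrite CU in Ul, Uu; rewrite !Cmod_polar in Uu by lra.
assert (Hsqrt2 : 0 < sqrt 2) by (apply sqrt_lt_R0; lra).
assert (Hsqrt2' : sqrt 2 * sqrt 2 = 2) by (apply sqrt_sqrt; lra).
(* The angle [theta - s] is at most [PI / 4]; this extreme angle matches the [sqrt 2] in [alpha]. *)
assert (Hcos : sqrt 2 / 2 <= cos (theta - s)).
{ apply Rle_trans with (cos (PI / 4)).
  - rewrite cos_PI4; right; apply Rmult_eq_reg_r with (sqrt 2); [|lra].
    unfold Rdiv; rewrite Rmult_1_l, Rinv_l by lra; lra.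
  - apply cos_decr_1; lra. }
destruct (y0_facts xi r U Hxi Hr HU HrU ltac:(nra) Uu) as (HYr & HY1 & HY2 & HYne).
change (yseq xi theta 1) with (ystep xi theta (yseq xi theta 0)).
destruct (yseq_sector xi theta 0 Hxi Hth) as (R & d & HR & Hd & ER).
destruct (ystep_bounds xi theta r s R d _ Hxi Hth Hr Hs E HR Hd ER)
  as (_ & T & N & HB).
rewrite CU in HB.
change (yseq xi theta 0) with (RtoC (Rpower (xi / alpha) (2 / 9))) in *.
set (Y := Rpower (xi / alpha) (2 / 9)) in *.
split.
(* For [theta > 0] the root [y*] is not real, whereas [y_0] is. *)
{ intros HY; destruct (Req_dec theta 0) as [->|Ht].
  - assert (s = 0) by lra; subst s; rewrite <- RtoC_polar in HY.
    apply RtoC_inj in HY; apply HYne; [|exact HY].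
    rewrite <- CU, <- RtoC_polar, <- (RtoC_polar r), <- RtoC_plus, Cmod_R.
    apply Rabs_pos_eq; lra.
  - apply (f_equal snd) in HY; simpl in HY.
    assert (0 < sin (- s)) by (apply sin_gt_0; lra).
    rewrite sin_neg in *; nra. }
assert (CR : Cmod (polar 1 theta + Y)%C = R) by (rewrite ER; apply Cmod_polar; lra).
pose proof (Cmod_unit_add_sqr theta Y 0) as R2.
pose proof (Cmod_polar_add_ge 1 theta Y 0 ltac:(lra) ltac:(lra) ltac:(lra)) as Rl.
pose proof (Cmod_triangle (polar 1 theta) Y) as Ru.
rewrite <- RtoC_polar, CR in R2, Rl; rewrite CR, Cmod_R, Cmod_polar in Ru by lra.
rewrite Rabs_pos_eq in Ru by lra.
rewrite Rminus_0_r in R2.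
(* Compared with [y*], [y_0] has at least the modulus and makes no larger an angle with [u]. *)
assert (HUR : U <= R).
{ assert (cos (theta - s) <= cos theta) by (apply cos_decr_1; lra).
  assert (r * cos (theta - s) <= Y * cos theta)
    by (apply Rmult_le_compat; lra).
  pose proof (pow_incr r Y 2 ltac:(lra)).
  apply Rsqr_incr_0_var; [rewrite !Rsqr_pow2|]; lra. }
set (e := Cmod (Y - polar r s)%C) in *.
assert (HRe : R <= U + e).
{ pose proof (Cmod_triangle (polar 1 theta + polar r s) (Y - polar r s))%C as H.
  replace (polar 1 theta + polar r s + (Y - polar r s))%C
    with (polar 1 theta + Y)%C in H by ring.
  rewrite CR, CU in H; exact H. }
assert (He : 0 <= e <= (Y - r) + - s * r).
{ split; [apply Cmod_ge_0|].
  pose proof (Cmod_triangle (Y - r) (r - polar r s))%C as H.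
  replace (Y - r + (r - polar r s))%C with (Y - polar r s)%C in H by ring.
  rewrite <- RtoC_minus, Cmod_R, Rabs_pos_eq in H by lra.
  pose proof (Cmod_chord_le r s ltac:(lra) ltac:(lra)); unfold e; lra. }
set (w := (0.92 * (r + / 5))) in *.
assert (Hw : 0 < w) by (unfold w; lra).
assert (HN : N <= 0.0043 * (4.85 * w ^ 4) /\ N <= 0.06 * w ^ 5).
{ destruct (Rle_dec r 16) as [H16|H16].
  - apply (first_step_near r U R T N e _ Y (- s) (conj Hr H16)
      ltac:(lra) HRe HB); lra.
  - pose proof (first_step_far r U R T N e _ Y (- s) ltac:(lra) ltac:(lra) HB
      HYr ltac:(lra) ltac:(intros; apply HY2; lra) He ltac:(lra) Harg) as HN.
    assert (0 <= (r + / 5) ^ 4) by (apply pow_le; lra).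
    assert (H4 : N <= 0.0043 * (4.85 * w ^ 4))
      by (unfold w; rewrite Rpow_mult_distr; lra).
    split; [exact H4|apply Rle_trans with (1 := H4)].
    pose proof (pow_lt w 4 Hw); change (w ^ 5) with (w * w ^ 4).
    assert (1 * w ^ 4 <= w * w ^ 4)
      by (apply Rmult_le_compat_r; [|unfold w]; lra).
    lra. }
destruct HN as [H4 H5]; destruct HB as [_ _ _ _ He']; specialize (He' H5).
fold w in He'.
apply Rmult_le_reg_l with (4.85 * w ^ 4); [pose proof (pow_lt w 4 Hw)|]; lra.
Qed.

(** * Induction along the sequence *)

Theorem theorem3 (xi theta : R) (ystar : C)
  (hxi : 0 < xi) (htheta : 0 <= theta <= PI / 5)
  (hystar : is_ystar xi theta ystar) :
  forall k : nat, (1 <= k)%nat ->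
    Cmod (yseq xi theta (S k) - ystar)%C
      < / 15.44 * Cmod (yseq xi theta k - ystar)%C /\
    Cmod (yseq xi theta (S k) - ystar)%C < 4.32e-3 / 15.44 ^ k.
Proof.
destruct (ystar_polar xi theta ystar htheta hystar)
  as (r & s & Hr & Hs & Hs0 & -> & E).
pose proof PI_RGT_0 as HPI.
destruct (first_step_bound xi theta r s hxi htheta Hr Hs Hs0 E) as [H0 H1].
assert (Hne : forall k, yseq xi theta k <> polar r s).
{ induction k as [|k IH]; [exact H0|]; intros Hk; apply IH.
  destruct (yseq_sector xi theta k hxi htheta) as (R & d & HR & Hd & ER).
  apply (ystep_bounds xi theta r s R d _ hxi htheta Hr Hs E HR Hd ER).
  exact Hk. }
pose proof (Cmod_polar_add_ge 1 theta r s ltac:(lra) ltac:(lra) ltac:(lra)) as HU.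
assert (Step : forall k, Cmod (yseq xi theta k - polar r s)%C <= 0.00432 ->
  Cmod (yseq xi theta (S k) - polar r s)%C
    < / 15.44 * Cmod (yseq xi theta k - polar r s)%C).
{ intros k Hk.
  destruct (yseq_sector xi theta k hxi htheta) as (R & d & HR & Hd & ER).
  destruct (ystep_bounds xi theta r s R d _ hxi htheta Hr Hs E HR Hd ER)
    as (_ & T & N & HB).
  apply (step_contracts _ _ _ _ _ _ _ Hr HB HU).
  - assert (CR : Cmod (polar 1 theta + yseq xi theta k)%C = R)
      by (rewrite ER; apply Cmod_polar; lra).
    pose proof (Cmod_triangle (polar 1 theta + polar r s)
      (yseq xi theta k - polar r s))%C as T1.
    pose proof (Cmod_triangle (polar 1 theta + yseq xi theta k)
      (- (yseq xi theta k - polar r s)))%C as T2.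
    rewrite Cmod_opp in T2.
    replace (polar 1 theta + polar r s + (yseq xi theta k - polar r s))%C
      with (polar 1 theta + yseq xi theta k)%C in T1 by ring.
    replace (polar 1 theta + yseq xi theta k + - (yseq xi theta k - polar r s))%C
      with (polar 1 theta + polar r s)%C in T2 by ring.
    lra.
  - split; [|exact Hk].
    apply Cmod_gt_0; intros Z; apply (Hne k).
    transitivity (yseq xi theta k - polar r s + polar r s)%C; [ring|].
    rewrite Z; ring. }
assert (Hpow : forall k, 1 <= 15.44 ^ k) by (intros k; apply pow_R1_Rle; lra).
(* The induction starts at [y_1], so the exponent lags the index by one. Since [0.0043 < C_0], the
   second claim comes out strict, and every error from [y_1] on is small enough for [Step]. *)
assert (Bound : forall k, Cmod (yseq xi theta (S k) - polar r s)%C * 15.44 ^ k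
  <= 0.0043).
{ induction k as [|k IH]; [rewrite Rmult_1_r; exact H1|].
  pose proof (Hpow k).
  pose proof (Cmod_ge_0 (yseq xi theta (S k) - polar r s)%C).
  pose proof (Step (S k) ltac:(nra)).
  change (15.44 ^ S k) with (15.44 * 15.44 ^ k); nra. }
intros k Hk; destruct k as [|k]; [lia|].
pose proof (Hpow k); pose proof (Bound k); pose proof (Bound (S k)).
pose proof (Cmod_ge_0 (yseq xi theta (S k) - polar r s)%C).
split; [apply Step; nra|].
pose proof (Hpow (S k)).
apply Rmult_lt_reg_r with (15.44 ^ S k); [lra|].
unfold Rdiv; rewrite Rmult_assoc, Rinv_l by lra; lra.
Qed.
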